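(* Let $p$ be a prime, let $\Phi:\mathbb{Z}_p\to\mathbb{Z}_p$ be a non-constant map with $\Phi(x)=\Phi(-x)$ for all $x\in \mathbb{Z}_p$, and let $\alpha\in\mathbb{Z}_p^*$ be such that $\Phi(\alpha x)=\alpha\Phi(x)$ for all $x\in\mathbb{Z}_p$. Put $t=\alpha^{-1}$ and $f:\mathbb{Z}_p\to\mathbb{Z}_p$, $f(i)=-\Phi(\alpha i)$. Then: (i) $f(i)=f(-i)$ for all $i\in\mathbb{Z}_p$; $f(t^s i)=t^s f(i)-(t^s-1)f(0)$ for all $i\in\mathbb{Z}_p$ and $s\in\mathbb{Z}$; and $f$ is not constant. (ii) The map $\Psi:\mathbb{Z}_p\times\mathbb{Z}_p\to\mathbb{Z}_p\times\mathbb{Z}_p$, $\Psi(i,j)=(i,-j)$, is an isomorphism between the solution $r^{\Phi,\alpha}$ and the solution $r^{f,t}$ on $\mathbb{Z}_p\times\mathbb{Z}_p$. Consequently, every indecomposable irretractable (finite, involutive, non-degenerate) set-theoretical solution of size $p^2$ is isomorphic to a solution $r^{f,t}$ for some $t\in\mathbb{Z}_p\setminus\{0\}$ and some map $f:\mathbb{Z}_p\to\mathbb{Z}_p$ satisfying the three conditions in (i).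
   Context: A set-theoretical solution to the Yang--Baxter equation is a pair $(X,r)$ with $r:X^2\to X^2$ a bijection such that $(r \times \mathrm{id}_X) (\mathrm{id}_X \times r)(r \times \mathrm{id}_X) = (\mathrm{id}_X \times r)(r \times \mathrm{id}_X) (\mathrm{id}_X \times r)$. Write $r(x,y)=(\lambda_x(y),\rho_y(x))$. All solutions are finite, non-degenerate (all $\lambda_x,\rho_x$ bijective) and involutive ($r^2=\mathrm{id}$); then $\rho_y(x)=\lambda_{\lambda_x(y)}^{-1}(x)$, so $r$ is determined by the maps $\lambda_x$. An isomorphism $(X,r)\to(Y,s)$ is a bijection $g:X\to Y$ with $(g\times g)r=s(g\times g)$. The solution is indecomposable if there is no partition $X=A\sqcup B$ into non-empty subsets with $r(A^2)=A^2$, $r(B^2)=B^2$; it is irretractable if $\lambda_x=\lambda_y$ implies $x=y$. For $\Phi,\alpha$ as in the claim, $r^{\Phi,\alpha}$ is the solution on $\mathbb{Z}_p\times\mathbb{Z}_p$ whose first component is given by $$\lambda_{(a,x)}(b,y)=(\alpha^{-1}b-x,\ \alpha^{-1}y-\Phi(\alpha^{-1}b-x-a)).$$ For $t\in\mathbb{Z}_p\setminus\{0\}$ and $f:\mathbb{Z}_p\to\mathbb{Z}_p$ satisfying the three conditions in (i) (evenness, the relation for $f(t^si)$, non-constancy), $r^{f,t}$ is the solution on $\mathbb{Z}_p\times\mathbb{Z}_p$ (constructed by Cedó and Okniński) whose first component is given by $$\lambda_{(i,j)}(k,l)=(tk+j,\ t(l-f(tk+j-i))),$$ and whose second component is $\lambda^{-1}_{\lambda_{(i,j)}(k,l)}(i,j)$.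 *)

(* Defs.v *)
From mathcomp Require Import all_boot all_order all_algebra.
Set Implicit Arguments.
Unset Strict Implicit.
Unset Printing Implicit Defensive.
Import GRing.Theory.
Local Open Scope ring_scope.

Section Solutions.
Variable X : Type.
Variable r : X * X -> X * X.

(* r (x, y) = (lambda r x y, rho r y x) *)
Definition lambda (x y : X) : X := (r (x, y)).1.
Definition rho (y x : X) : X := (r (x, y)).2.

(* r \times id and id \times r on X^3, with X^3 encoded as (X * X) * X *)
Definition r12 (u : X * X * X) : X * X * X :=
  let: (x, y, z) := u in ((r (x, y)).1, (r (x, y)).2, z).
Definition r23 (u : X * X * X) : X * X * X :=
  let: (x, y, z) := u in (x, (r (y, z)).1, (r (y, z)).2).

Definition yang_baxter : Prop := r12 \o r23 \o r12 =1 r23 \o r12 \o r23.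

Definition non_degenerate : Prop :=
  (forall x, bijective (lambda x)) /\ (forall y, bijective (rho y)).

Definition solution : Prop :=
  [/\ bijective r, yang_baxter, non_degenerate & involutive r].

Definition irretractable : Prop :=
  forall x y, lambda x =1 lambda y -> x = y.

End Solutions.

Definition isomorphism (X Y : Type) (r : X * X -> X * X) (s : Y * Y -> Y * Y)
    (g : X -> Y) : Prop :=
  let gg (u : X * X) := (g u.1, g u.2) in
  bijective g /\ gg \o r =1 s \o gg.

Definition indecomposable (X : finType) (r : X * X -> X * X) : Prop :=
  ~ exists A B : {set X},
      [/\ A :|: B = [set: X], A :&: B = set0, A != set0 & B != set0]
      /\ r @: setX A A = setX A A /\ r @: setX B B = setX B B.

(* The map r (x, y) = (l_x(y), l_{l_x(y)}^{-1}(x)) determined by a family l of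
   permutations of a finite set; [finv] is the inverse of an injective
   self-map of a finite type. *)
Definition map_of_lambda (X : finType) (l : X -> X -> X) (u : X * X) : X * X :=
  let: (x, y) := u in (l x y, finv (l (l x y)) x).

Definition non_constant (A B : Type) (h : A -> B) : Prop :=
  ~ exists c, forall x, h x = c.

Section Families.
Variable p : nat.

Definition lambda_Phi (Phi : 'F_p -> 'F_p) (alpha : 'F_p)
    (u v : 'F_p * 'F_p) : 'F_p * 'F_p :=
  let: (a, x) := u in let: (b, y) := v in
  (alpha^-1 * b - x, alpha^-1 * y - Phi (alpha^-1 * b - x - a)).

Definition r_Phi (Phi : 'F_p -> 'F_p) (alpha : 'F_p) :=
  map_of_lambda (lambda_Phi Phi alpha).

(* The family constructed by Cedo and Okninski. *)
Definition lambda_f (f : 'F_p -> 'F_p) (t : 'F_p)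
    (u v : 'F_p * 'F_p) : 'F_p * 'F_p :=
  let: (i, j) := u in let: (k, l) := v in
  (t * k + j, t * (l - f (t * k + j - i))).

Definition r_f (f : 'F_p -> 'F_p) (t : 'F_p) :=
  map_of_lambda (lambda_f f t).

Definition admissible (f : 'F_p -> 'F_p) (t : 'F_p) : Prop :=
  [/\ forall i, f i = f (- i),
      forall (i : 'F_p) (s : int),
        f (t ^ s * i) = t ^ s * f i - (t ^ s - 1) * f 0
    & non_constant f].

End Families.

(* Main.v *)
(** Put s_x = lambda_x^-1. The maps s_x generate a permutation group G, transitive
    because the solution is indecomposable, and G carries a second, abelian group
    structure A (the additive group of the permutation brace), generated by
    elements t_x which G permutes as it permutes X. For a set w of primes, the Hall
    subgroup A_w is G-stable, so it is also a Hall subgroup of G; let P and Q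
    be the p- and p'-parts. Then G = PQ, and P is transitive on X.

    The kernel of G on A_p is trivial: its p'-part is normalized by P and Q, and a
    normal p'-subgroup of a transitive group of degree p^2 is trivial; so the kernel
    is a normal p-subgroup, hence it centralizes A_p' as well, and it is trivial by
    irretractability.

    Let z be a central element of order p of P and N the kernel of P on the
    z-orbits, an abelian subgroup of index p. Since A is generated by the t_x, N
    acts trivially on A_p / W, where W = [A_p, z]. If z is chosen with |W| minimal,
    then the subgroup of P corresponding to W meets N trivially, so W has
    prime order p and P fixes it pointwise. A generator of W corresponds to an
    element sigma of P that is an automorphism of the p-part of the solution, and X
    is a regular orbit of <sigma> x <z>; in these coordinates the p-part is
    determined by a single function.

    By Burnside's theorem the subgroups A_p A_r of G, with r prime, are solvable,
    which forces z, then N, and finally P to centralize A_p'. So the p'-part of s_x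
    does not depend on x, and it acts on the coordinates as a scalar. *)

Require Import Defs.
From mathcomp Require Import all_boot all_order all_algebra.
From mathcomp Require Import all_fingroup all_solvable all_character ring.
Set Implicit Arguments.
Unset Strict Implicit.
Unset Printing Implicit Defensive.
Import GRing.Theory.

(** * Transitive groups of prime-power degree *)

Section PermutationGroups.

Local Open Scope group_scope.

(** In a finite group inverses are products of generators, so closure under products reaches all of
    [<<S>>]. *)
Lemma gen_ind (gT : finGroupType) (S : {set gT}) (K : gT -> Prop) :
    K 1 -> (forall x y, K x -> K y -> K (x * y)) ->
  {in S, forall x, K x} -> {in <<S>>, forall x, K x}.
Proof.
move=> K1 KM KS x /gen_prodgP[n [c cS ->]].
by elim/big_ind: _ => // i _; apply: KS.
Qed.

(** As K is normal, K L_x is a subgroup; its order is the orbit length times |L_x|, and it divides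
    |L| = |X| |L_x|. *)
Lemma normal_orbit_dvd (X : finType) (L K : {group {perm X}}) (x : X) :
    [transitive L, on [set: X] | 'P] -> K <| L ->
  #|orbit 'P K x| %| #|X|.
Proof.
move=> trL /andP[sKL nKL].
have cardL : (#|X| * #|'C_L[x | 'P]| = #|L|)%N.
  by rewrite -cardsT -(atransP trL x) ?inE // card_orbit_stab.
have cardK : (#|orbit 'P K x| * #|'C_K[x | 'P]| = #|K|)%N.
  exact: card_orbit_stab.
have nKS : 'C_L[x | 'P] \subset 'N(K) by rewrite (subset_trans (subsetIl _ _)).
have := mul_cardG K 'C_L[x | 'P]; rewrite -norm_joinEr //.
have -> : K :&: 'C_L[x | 'P] = 'C_K[x | 'P].
  by rewrite setIA (setIidPl sKL).
rewrite -cardK mulnAC => /eqP; rewrite eqn_pmul2r ?cardG_gt0 // => /eqP E.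
have : #|(K <*> 'C_L[x | 'P])%G| %| #|L|.
  by apply: cardSg; rewrite join_subG sKL subsetIl.
by rewrite /= -E -cardL dvdn_pmul2r.
Qed.

(** Each orbit length of K divides both |X| and |K|. *)
Lemma normal_coprime_degree_triv (X : finType) (L K : {group {perm X}}) :
    [transitive L, on [set: X] | 'P] -> K <| L -> coprime #|X| #|K| ->
  K :=: 1.
Proof.
move=> trL nKL co; apply/trivgP/subsetP=> k kK; rewrite inE.
apply/eqP/permP=> x; rewrite perm1.
have d1 := normal_orbit_dvd x trL nKL.
have d2 : #|orbit 'P K x| %| #|K| by apply: dvdn_orbit.
have : #|orbit 'P K x| == 1%N.
  by rewrite -dvdn1 -(eqP co) dvdn_gcd d1.
move=> /cards1P[y E].
have : k x \in orbit 'P K x by apply/orbitP; exists k.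
have : x \in orbit 'P K x by apply: orbit_refl.
by rewrite E !inE => /eqP-> /eqP.
Qed.

(** |S| is p^k times the p-part of |L_x|, while |S_x| is at most that p-part. *)
Lemma Sylow_transitive (X : finType) (p k : nat) (L S : {group {perm X}}) :
    prime p -> #|X| = (p ^ k)%N -> [transitive L, on [set: X] | 'P] ->
  p.-Sylow(L) S -> [transitive S, on [set: X] | 'P].
Proof.
move=> p_pr cX trL sylS.
have [x _] : exists x, x \in [set: X].
  by apply/card_gt0P; rewrite cardsT cX expn_gt0 prime_gt0.
apply/imsetP; exists x; first by rewrite inE.
apply/esym/eqP; rewrite eqEcard subsetT cardsT cX.
have cL : (p ^ k * #|'C_L[x | 'P]| = #|L|)%N.
  by rewrite -cX -cardsT -(atransP trL x) ?inE // card_orbit_stab.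
have cS := card_orbit_stab 'P S x.
have cC : #|'C_S[x | 'P]| <= #|'C_L[x | 'P]|`_p.
  apply: dvdn_leq; first exact: part_gt0.
  have pC : p.-nat #|'C_S[x | 'P]|.
    exact: pgroupS (subsetIl _ _) (pHall_pgroup sylS).
  rewrite -(part_pnat_id pC) partn_dvd // cardSg //.
  by apply: setSI; apply: pHall_sub sylS.
have : (#|L|`_p = p ^ k * #|'C_L[x | 'P]|`_p)%N.
  have pk : ((p ^ k)`_p = p ^ k)%N by rewrite part_pnat_id // pnatX pnat_id.
  by rewrite -cL partnM ?pk ?cardG_gt0 // expn_gt0 prime_gt0.
rewrite -(card_Hall sylS) -cS => E.
rewrite -(leq_pmul2r (part_gt0 p #|'C_L[x | 'P]|)) -E leq_mul2l.
by rewrite cC orbT.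
Qed.

(** * The permutation brace of a cycle set *)

Section CycleSet.

Variables (X : finType) (s : X -> {perm X}).
(** With x.y = [s x y] and products of permutations read from left to right, this is the cycle set
    identity (x.y).(x.z) = (y.x).(y.z); [diag_inj] is non-degeneracy. *)
Hypothesis cycle_eq : forall x y, s x * s (s x y) = s y * s (s y x).
Hypothesis diag_inj : injective (fun x => s x x).

Definition perm_grp : {group {perm X}} := <<[set s x | x : X]>>%G.
Local Notation G := perm_grp.

Lemma s_in_perm_grp x : s x \in G.
Proof. by apply: mem_gen; apply: imset_f. Qed.

(* Addition of s x in the permutation brace: g + s x = g o s (g x). *)
Definition transl_fun x (g : {perm X}) :=
  if g \in G then g * s (g x) else g.

(** The value of [g * s (g x)] at [x] is the square of [g x]; by [diag_inj] it determines [g x], and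
    then [g]. *)
Lemma transl_fun_inj x : injective (transl_fun x).
Proof.
have stab g : (transl_fun x g \in G) = (g \in G).
  by rewrite /transl_fun; case: ifP => gG; rewrite ?groupMr ?s_in_perm_grp ?gG.
move=> g h E; have := congr1 (fun u => u \in G) E; rewrite !stab.
move: E; rewrite /transl_fun; case: ifP => gG; case: ifP => hG // E _.
have Ex : g x = h x.
  by apply: diag_inj; have := congr1 (fun u : {perm X} => u x) E; rewrite !permM.
by move: E; rewrite Ex => /mulIg.
Qed.

Definition transl x : {perm {perm X}} := perm (@transl_fun_inj x).
Local Notation t := transl.

(* The additive group of the permutation brace, acting regularly on [perm_grp]. *)
Definition add_grp : {group {perm {perm X}}} := <<[set t x | x : X]>>%G.
Local Notation A := add_grp.

Lemma transl_in x : t x \in A.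
Proof. by apply: mem_gen; apply: imset_f. Qed.

Lemma translE x g : g \in G -> t x g = g * s (g x).
Proof. by move=> gG; rewrite permE /transl_fun gG. Qed.

Lemma transl_out x g : g \notin G -> t x g = g.
Proof. by move=> gG; rewrite permE /transl_fun (negPf gG). Qed.

(** At [g] in G this is the cycle set identity for [g x] and [g y]. *)
Lemma transl_commute x y : commute (t x) (t y).
Proof.
apply/permP=> g; rewrite !permM.
have [gG | gG] := boolP (g \in G); last by rewrite !transl_out.
rewrite !translE ?groupM ?s_in_perm_grp // -!mulgA !permM; congr (_ * _); exact: cycle_eq.
Qed.

Lemma add_abelian : abelian A.
Proof.
rewrite /abelian /= cent_gen gen_subG; apply/subsetP=> _ /imsetP[x _ ->].
by apply/centP=> _ /imsetP[y _ ->]; apply: transl_commute.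
Qed.

Lemma add_grpC a b : a \in A -> b \in A -> a * b = b * a.
Proof. by move=> aA bA; apply: (centsP add_abelian). Qed.

Lemma ell_inj (h : {perm X}) : injective (fun g : {perm X} => h^-1 * g).
Proof. by move=> g k /mulgI. Qed.

(** The inverse makes [ell] a homomorphism; conjugation by [ell h] is the brace action of G on A,
    see [transl_conj]. *)
Definition ell h : {perm {perm X}} := perm (@ell_inj h).

Lemma ellE h g : ell h g = h^-1 * g. Proof. by rewrite permE. Qed.

Lemma ellM : {in [set: {perm X}] &, {morph ell : g h / g * h}}.
Proof.
by move=> g h _ _; apply/permP=> k; rewrite permM !ellE invMg mulgA.
Qed.
Canonical ell_morphism := Morphism ellM.

Lemma ell_M g h : ell (g * h) = ell g * ell h.
Proof. by rewrite ellM ?inE. Qed.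

Lemma ell_V h : ell h^-1 = (ell h)^-1.
Proof. by rewrite morphV ?inE. Qed.

Lemma ell_1 : ell 1 = 1.
Proof. exact: morph1. Qed.

Lemma transl_conj x h : h \in G -> t x ^ ell h = t (h x).
Proof.
move=> hG; apply/permP=> g; rewrite conjgE !permM -ell_V !ellE invgK.
have [gG | gG] := boolP (g \in G).
  by rewrite !translE ?groupM ?gG // permM -mulgA mulKg.
by rewrite !transl_out ?groupMl ?mulKg.
Qed.

Lemma add_stable : ell @* G \subset 'N(A).
Proof.
apply/subsetP=> _ /morphimP[h _ hG ->]; rewrite inE /= -genJ gen_subG.
apply/subsetP=> _ /imsetP[_ /imsetP[x _ ->] ->].
by rewrite transl_conj // mem_gen ?imset_f.
Qed.

(* The base point 1 identifies the additive group with [perm_grp]; [pi_M] says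
   that this identification is a 1-cocycle. *)
Definition pi_ (a : {perm {perm X}}) : {perm X} := a 1.

Lemma pi_transl x : pi_ (t x) = s x.
Proof. by rewrite /pi_ translE // mul1g perm1. Qed.

Lemma pi_1 : pi_ 1 = 1.
Proof. by rewrite /pi_ perm1. Qed.

Lemma pi_M a b : pi_ (a * b) = pi_ a * pi_ (b ^ ell (pi_ a)).
Proof.
by rewrite /pi_ conjgE !permM -ell_V !ellE invgK mulg1 mulKVg.
Qed.

Lemma add_act a g : a \in A -> (a g \in G) = (g \in G).
Proof.
move=> aA; move: a aA g; apply: gen_ind => [g|a b IHa IHb g|_ /imsetP[x _ ->] g].
- by rewrite perm1.
- by rewrite permM IHb.
by rewrite permE /transl_fun; case: ifP => gG; rewrite ?groupM ?s_in_perm_grp ?gG.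
Qed.

Lemma pi_in a : a \in A -> pi_ a \in G.
Proof. by move=> aA; rewrite /pi_ add_act. Qed.

Lemma add_out a g : a \in A -> g \notin G -> a g = g.
Proof.
move=> aA gG; move: a aA; apply: gen_ind => [|a b IHa IHb|_ /imsetP[x _ ->]].
- by rewrite perm1.
- by rewrite permM IHa IHb.
exact: transl_out.
Qed.

Lemma pi_surj : G = pi_ @: A :> {set _}.
Proof.
apply/eqP; rewrite eqEsubset; apply/andP; split; last first.
  by apply/subsetP=> _ /imsetP[a aA ->]; apply: pi_in.
apply/subsetP=> g gG.
suffices K : forall h, h \in pi_ @: A -> h * g \in pi_ @: A.
  by rewrite -[g]mul1g K // -pi_1 imset_f.
move: g gG; apply: gen_ind => [h|g k IHg IHk h hA|_ /imsetP[x _ ->] h].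
- by rewrite mulg1.
- by rewrite mulgA IHk // IHg.
(* Appending [t y] multiplies [pi_ a] by [s (pi_ a y)], so [x] is pulled back along [pi_ a]. *)
case/imsetP=> a aA ->; apply/imsetP; exists (a * t ((pi_ a)^-1 x)).
  by rewrite groupM ?transl_in.
by rewrite {2}/pi_ permM -/(pi_ a) translE ?pi_in // permKV.
Qed.

(** A is abelian and transitive on G, so an element fixing 1 fixes all of G; outside G it acts
    trivially. *)
Lemma pi_inj : {in A &, injective pi_}.
Proof.
move=> a b aA bA E; apply/eqP; rewrite eq_mulgV1; apply/eqP.
have uA : a * b^-1 \in A by rewrite groupM ?groupV.
set u := a * b^-1 in uA *.
have u1 : u 1 = 1.
  by rewrite permM -/(pi_ a) E /pi_ permK.
apply/permP=> g; rewrite perm1.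
have [|gG] := boolP (g \in G); last exact: add_out.
rewrite pi_surj => /imsetP[c cA ->].
by rewrite /pi_ -permM add_grpC // permM u1.
Qed.

(* Commutativity of addition, in multiplicative terms. *)
Lemma pi_star a b : a \in A -> b \in A ->
  pi_ a * pi_ (b ^ ell (pi_ a)) = pi_ b * pi_ (a ^ ell (pi_ b)).
Proof. by move=> aA bA; rewrite -!pi_M add_grpC. Qed.

(** * Sub-braces and Hall parts *)

Implicit Types S T : {group {perm {perm X}}}.

Definition sub_brace (S : {group {perm {perm X}}}) :=
  S \subset A /\ forall a b, a \in S -> b \in S -> b ^ ell (pi_ a) \in S.

Lemma sub_brace_group_set S : sub_brace S -> group_set (pi_ @: S).
Proof.
case=> sSA stS; apply/group_setP; split; first by rewrite -pi_1 imset_f.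
have KV a : a \in S -> {in S, forall b, b ^ ell (pi_ a)^-1 \in S}.
  move=> aS b bS.
  have nS : (ell (pi_ a)) \in 'N(S).
    by rewrite inE; apply/subsetP=> _ /imsetP[c cS ->]; apply: stS.
  by rewrite ell_V memJ_norm ?groupV.
move=> _ _ /imsetP[a aS ->] /imsetP[b bS ->].
apply/imsetP; exists (a * b ^ ell (pi_ a)^-1); first by rewrite groupM ?KV.
by rewrite pi_M -conjgM -ell_M mulVg ell_1 conjg1.
Qed.

(** Generation yields a group for every [S]; for a sub-brace it is the plain image, see [pigrpE]. *)
Definition pigrp (S : {group {perm {perm X}}}) : {group {perm X}} :=
  (<<[set pi_ a | a in S]>>)%G.

Lemma pigrpE S : sub_brace S -> pigrp S = pi_ @: S :> {set _}.
Proof. by move=> /sub_brace_group_set sS; apply: (gen_set_id sS). Qed.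

Lemma card_pigrp S : sub_brace S -> #|pigrp S| = #|S|.
Proof.
move=> bS; rewrite pigrpE // card_in_imset // => a b aS bS' E.
by case: bS => sSA _; apply: pi_inj => //; apply: (subsetP sSA).
Qed.

Lemma mem_pigrp S a : a \in S -> pi_ a \in pigrp S.
Proof. by move=> aS; apply: mem_gen; apply: imset_f. Qed.

Lemma pigrpP S g : sub_brace S -> g \in pigrp S -> exists2 a, a \in S & g = pi_ a.
Proof. by move=> /pigrpE E; rewrite -[_ \in _]/(g \in (pigrp S : {set _})) E => /imsetP. Qed.

Lemma pigrpS S T : S \subset T -> pigrp S \subset pigrp T.
Proof. by move=> sST; apply: genS; apply: imsetS. Qed.

Lemma stable_sub_brace (S : {group {perm {perm X}}}) :
  S \subset A -> ell @* G \subset 'N(S) -> sub_brace S.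
Proof.
move=> sSA /subsetP nS; split=> // a b aS bS.
by rewrite memJ_norm // nS // mem_morphim ?inE ?pi_in ?(subsetP sSA).
Qed.

Lemma add_sub_brace : sub_brace A.
Proof. exact: stable_sub_brace add_stable. Qed.

Lemma card_add : #|A| = #|G|.
Proof. by rewrite -(card_pigrp add_sub_brace) pigrpE ?pi_surj //; apply: add_sub_brace. Qed.

Section HallPart.
Variable w : nat_pred.
Local Notation Aw := 'O_w(A)%G.

Lemma hall_sub : Aw \subset A. Proof. exact: pcore_sub. Qed.

Lemma hall_stable : ell @* G \subset 'N(Aw).
Proof. exact: gFnorm_trans add_stable. Qed.

Lemma hall_sub_brace : sub_brace Aw.
Proof. exact: stable_sub_brace hall_sub hall_stable. Qed.

Lemma hall_Hall : w.-Hall(A) Aw.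
Proof. exact: nilpotent_pcore_Hall (abelian_nil add_abelian). Qed.

Definition transl_part x := (t x).`_w.

Lemma transl_part_in x : transl_part x \in Aw.
Proof.
rewrite (mem_normal_Hall hall_Hall) ?pcore_normal ?p_elt_constt //.
exact/groupX/transl_in.
Qed.

Lemma transl_part_conj x h : h \in G -> transl_part x ^ ell h = transl_part (h x).
Proof. by move=> hG; rewrite /transl_part -consttJ transl_conj. Qed.

(** On the abelian group A, taking w-constituents is multiplicative, and on A_w it is the
    identity. *)
Lemma transl_part_gen : Aw = <<[set transl_part x | x : X]>> :> {set _}.
Proof.
apply/eqP; rewrite eqEsubset; apply/andP; split; last first.
  by rewrite gen_subG; apply/subsetP=> _ /imsetP[x _ ->]; apply: transl_part_in.
apply/subsetP=> b bAw; have bA := subsetP hall_sub b bAw.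
rewrite -(constt_p_elt (mem_p_elt (pcore_pgroup _ _) bAw)).
suffices /(_ b bA) [] : {in A, forall a,
  a \in A /\ a.`_w \in <<[set transl_part x | x : X]>>} by [].
apply: gen_ind => [|a c [aA IHa] [cA IHc]|_ /imsetP[x _ ->]].
- by rewrite constt1.
- by rewrite groupM // consttM ?groupM //; apply: add_grpC.
by split=> //; apply: mem_gen; apply: imset_f.
Qed.

Lemma pihall_Hall : w.-Hall(G) (pigrp Aw).
Proof.
have sb := hall_sub_brace; rewrite pHallE card_pigrp // (card_Hall hall_Hall) card_add.
rewrite eqxx andbT pigrpE // pi_surj; exact: imsetS hall_sub.
Qed.

End HallPart.

(** * Degree p^2: faithfulness of the action on the p-part *)

Section PrimeSquare.

Variable p : nat.
Hypothesis p_pr : prime p.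
Hypothesis cardX : #|X| = (p ^ 2)%N.
Hypothesis s_inj : injective s.
Hypothesis trG : [transitive G, on [set: X] | 'P].

Local Notation O w := 'O_w(A)%G.
Local Notation B := 'O_p(A)%G.
Local Notation P := (pigrp B).
Local Notation Q w := (pigrp 'O_w(A)%G).

Lemma O_stable w a g : a \in O w -> g \in G -> a ^ ell g \in O w.
Proof.
by move=> aR gG; rewrite memJ_norm // (subsetP (hall_stable w)) // mem_morphim ?inE.
Qed.

Lemma O_in w a : a \in O w -> a \in A.
Proof. exact: subsetP (hall_sub w) a. Qed.

Lemma Q_sub w : Q w \subset G.
Proof. exact: pHall_sub (pihall_Hall w). Qed.

Lemma Q_in w g : g \in Q w -> g \in G.
Proof. exact: subsetP (Q_sub w) g. Qed.

Lemma QP w g : g \in Q w -> exists2 a, a \in O w & g = pi_ a.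
Proof. exact: pigrpP (hall_sub_brace w). Qed.

Lemma P_Q_TI w : p \notin w -> P :&: Q w = 1.
Proof.
move=> pw; apply: coprime_TIg.
apply: (@pnat_coprime p); first exact: pHall_pgroup (pihall_Hall p).
apply: sub_pgroup (pHall_pgroup (pihall_Hall w)) => q qw.
by apply: contraNneq pw => <-.
Qed.

(* In [pi_star], P and Q intersect trivially, so a factorization is unique. *)
Lemma conj_in_P w b c : p \notin w -> b \in B -> c \in O w ->
    pi_ b ^ pi_ c \in P ->
  c ^ ell (pi_ b) = c /\ pi_ b ^ pi_ c = pi_ (b ^ ell (pi_ c)).
Proof.
move=> pw bB cR gqP.
have st := pi_star (O_in bB) (O_in cR).
have y1 : (pi_ c)^-1 * pi_ (c ^ ell (pi_ b)) = 1.
  apply/set1P; rewrite -[[set 1]](P_Q_TI pw) inE; apply/andP; split; last first.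
    by rewrite groupM ?groupV ?mem_pigrp ?O_stable ?pi_in ?(O_in bB).
  have -> : (pi_ c)^-1 * pi_ (c ^ ell (pi_ b)) =
      (pi_ b ^ pi_ c)^-1 * pi_ (b ^ ell (pi_ c)).
    apply: (mulgI (pi_ b ^ pi_ c)); rewrite mulKVg conjgE !mulgA mulgK.
    by rewrite -mulgA st mulKg.
  by rewrite groupM ?groupV ?mem_pigrp ?O_stable ?pi_in ?(O_in cR).
have E : pi_ (c ^ ell (pi_ b)) = pi_ c by apply/esym/eqP; rewrite eq_mulVg1 y1.
split; first by apply: pi_inj; rewrite // ?(O_in cR) ?(O_in (O_stable cR _)) ?pi_in ?(O_in bB).
by rewrite conjgE -{2}E st mulKg.
Qed.

(** When [pi_ b] fixes [c], [pi_star] identifies conjugation by [pi_ c] with the brace action on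
    [b]. *)
Lemma cent_conj v w b c : b \in O v -> c \in O w ->
    ell (pi_ b) \in 'C(O w) -> pi_ b ^ pi_ c = pi_ (b ^ ell (pi_ c)).
Proof.
move=> bR cR /centP/(_ c cR) cc.
have := pi_star (O_in bR) (O_in cR).
rewrite (_ : c ^ ell (pi_ b) = c); last by apply/conjg_fixP/commgP.
by move=> E; rewrite conjgE E mulKg.
Qed.

Definition act_cent w : {group {perm X}} := (ell @*^-1 'C(O w))%G.

Lemma act_centE w g : (g \in act_cent w) = (ell g \in 'C(O w)).
Proof. by rewrite !inE. Qed.

Lemma act_cent_norm w : G \subset 'N(act_cent w).
Proof.
apply/subsetP=> k kG; rewrite inE; apply/subsetP=> _ /imsetP[g gC ->].
move: gC; rewrite !act_centE => gC; rewrite -/(ell _) morphJ ?inE // memJ_norm //.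
apply: (subsetP (cent_norm _)); apply: (subsetP (hall_stable w)).
by rewrite mem_morphim ?inE.
Qed.

Lemma act_cent_Q_norm v w : Q w \subset 'N(Q v :&: act_cent w).
Proof.
apply/subsetP=> _ /QP[c cR ->]; rewrite inE; apply/subsetP=> _ /imsetP[g + ->].
case/setIP=> /QP[b bR ->] bC; rewrite in_setI.
have cG : pi_ c \in G by rewrite pi_in ?(O_in cR).
apply/andP; split; last by rewrite memJ_norm // (subsetP (act_cent_norm w)).
by move: bC; rewrite act_centE => /(cent_conj bR cR) ->; rewrite mem_pigrp ?O_stable.
Qed.

Definition PQ w : {group {perm X}} := pigrp (B <*> O w)%G.

Lemma PQ_brace w : sub_brace (B <*> O w)%G.
Proof.
apply: stable_sub_brace; first by rewrite join_subG !hall_sub.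
by apply: normsY; apply: hall_stable.
Qed.

Lemma PQ_mul w : PQ w = P * Q w :> {set _}.
Proof.
apply/eqP; rewrite eqEsubset; apply/andP; split; last first.
  by rewrite mul_subG // pigrpS ?joing_subl ?joing_subr.
apply/subsetP=> g /(pigrpP (PQ_brace w))[a].
rewrite /= norm_joinEl; last first.
  by rewrite (subset_trans (hall_sub p)) // (subset_trans _ (cent_sub _)) //
    (subset_trans add_abelian) // centS ?hall_sub.
case/mulsgP=> b c bB cR -> ->; rewrite pi_M mem_mulg ?mem_pigrp //.
by rewrite O_stable ?pi_in ?(O_in bB).
Qed.

Lemma PQ_G : PQ p^' = G.
Proof.
have E : (B <*> O p^')%G = A.
  apply: val_inj => /=; have /dprodP[_ E cBC _] := nilpotent_pcoreC p (abelian_nil add_abelian).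
  by rewrite cent_joinEr.
rewrite /PQ E; apply: val_inj; apply: etrans (pigrpE add_sub_brace) _.
exact/esym/pi_surj.
Qed.

Lemma PQ_sub w : PQ w \subset G.
Proof. by rewrite PQ_mul mul_subG ?Q_sub. Qed.

Lemma P_trans : [transitive P, on [set: X] | 'P].
Proof. exact: Sylow_transitive p_pr cardX trG (pihall_Hall p). Qed.

Lemma PQ_trans w : [transitive PQ w, on [set: X] | 'P].
Proof.
have [x _] : exists x, x \in [set: X].
  by apply/card_gt0P; rewrite cardsT cardX expn_gt0 prime_gt0.
apply/imsetP; exists x; rewrite ?inE //; apply/esym/eqP.
rewrite eqEsubset subsetT -(atransP P_trans x) ?inE //=; apply: imsetS.
by rewrite PQ_mul mulG_subl.
Qed.

Lemma p'normal_triv w (K : {group {perm X}}) : K <| PQ w -> p^'.-group K -> K :=: 1.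
Proof.
move=> nK p'K; apply: (normal_coprime_degree_triv (PQ_trans w) nK).
by rewrite cardX; apply: (@pnat_coprime p); rewrite // pnatX pnat_id.
Qed.

(** If [g] fixes every [t x], then [s (g x) = s x], and [s_inj] (irretractability) applies. *)
Lemma faithful_A g : g \in G -> ell g \in 'C(A) -> g = 1.
Proof.
move=> gG /centP gC; apply/permP=> x; rewrite perm1; apply: s_inj.
rewrite -2!pi_transl -transl_conj //; congr pi_; apply/conjg_fixP/commgP/commute_sym.
by apply: gC; apply: transl_in.
Qed.

Lemma faithful_B g : g \in G -> ell g \in 'C(B) -> g = 1.
Proof.
set H := (G :&: act_cent p)%G.
have nHG : H <| G by rewrite /normal subsetIl normsI ?normG ?act_cent_norm.
have QH1 : Q p^' :&: act_cent p = 1.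
  apply: (@p'normal_triv p^' (Q p^' :&: act_cent p)%G).
    apply/andP; split; first by rewrite PQ_G subIset // Q_sub.
    rewrite PQ_mul; apply: mul_subG; first exact: (act_cent_Q_norm p^' p).
    by apply: normsI; [apply: normG | apply: subset_trans (Q_sub _) (act_cent_norm p)].
  exact: pgroupS (subsetIl _ _) (pHall_pgroup (pihall_Hall p^')).
have pH : p.-group H.
  have E : (Q p^' :&: H)%G = 1%G.
    by apply/val_inj/trivgP; rewrite -QH1 setIS // subsetIr.
  have := card_Hall (Hall_setI_normal nHG (pihall_Hall p^')).
  rewrite E cards1 => /esym/eqP.
  by rewrite partn_eq1 ?cardG_gt0 // pnatNK.
have HP : H \subset P.
  apply: subset_trans (pcore_sub_Hall (pihall_Hall p)).
  by apply: pcore_max.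
move=> gG gB; apply: faithful_A => //.
have gH : g \in H by rewrite inE gG act_centE.
have [b bB Eg] := QP (subsetP HP g gH).
(* A is the product of its p- and p'-parts. On the latter [conj_in_P] applies, because conjugates of
   [g] stay in H, hence in P. *)
suffices gC : ell g \in 'C(O p^').
  have /dprodP[_ E _ _] := nilpotent_pcoreC p (abelian_nil add_abelian).
  by rewrite -E centM inE gB.
apply/centP=> c cC; apply/commute_sym/commgP/conjg_fixP; rewrite Eg.
have [] // := @conj_in_P p^' b c; first by rewrite inE negbK inE.
have qG : pi_ c \in G by rewrite pi_in ?(O_in cC).
by rewrite (subsetP HP) // -Eg memJ_norm // (subsetP (normal_norm nHG)).
Qed.

(** * The p-part *)

Lemma P_transP x y : exists2 g, g \in P & y = g x.
Proof.
have [|//|g gP ->] := atransP2 P_trans (_ : x \in setT) (_ : y \in setT).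
  by rewrite inE.
by exists g.
Qed.

Lemma P_pgroup : p.-group P.
Proof. exact: pHall_pgroup (pihall_Hall p). Qed.

Lemma ellP_norm w : ell @* P \subset 'N(O w).
Proof. exact: subset_trans (morphimS _ (Q_sub p)) (hall_stable w). Qed.

Lemma ellP_act g (S : {group {perm {perm X}}}) b :
  g \in P -> ell @* P \subset 'N(S) -> b \in S -> b ^ ell g \in S.
Proof. by move=> gP /subsetP nS bS; rewrite memJ_norm // nS // mem_morphim ?inE. Qed.

Definition comg w z := [~: O w, <[ell z]>]%G.

Lemma comg_sub w z : z \in P -> comg w z \subset O w.
Proof.
move=> zP; rewrite commg_subl; apply: subset_trans (ellP_norm w).
by rewrite cycle_subG mem_morphim ?inE.
Qed.

Lemma comg_stable w z : z \in 'Z(P) -> ell @* P \subset 'N(comg w z).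
Proof.
case/centerP=> zP zC; apply: normsR (ellP_norm w) _; apply: cents_norm.
rewrite cent_cycle; apply/subsetP=> _ /morphimP[g _ gP ->].
by apply/cent1P; rewrite /commute -!ell_M zC.
Qed.

Lemma mem_comg w z b k : b \in O w -> [~ b, ell (z ^+ k)] \in comg w z.
Proof. by move=> bO; rewrite mem_commg // morphX ?inE // mem_cycle. Qed.

Local Notation W z := (comg p z).

Lemma stableP_sub_brace (S : {group {perm {perm X}}}) :
  S \subset B -> ell @* P \subset 'N(S) -> sub_brace S.
Proof.
move=> sSB nS; split=> [|a b aS bS]; first exact: subset_trans (hall_sub p).
by apply: ellP_act => //; rewrite mem_pigrp // (subsetP sSB).
Qed.

Lemma W_brace z : z \in 'Z(P) -> sub_brace (W z).
Proof.
move=> zZ; apply: stableP_sub_brace (comg_stable p zZ).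
by apply: comg_sub; apply: (subsetP (center_sub _)).
Qed.

(** Through [pi_M], [z * g = g * z] becomes an equality in A; cancelling [a] and [b] there trades
    the action of [z] on [b] for that of [g] on [a]. *)
Lemma central_comm z g a b : z \in 'Z(P) -> g \in P -> a \in B -> b \in B ->
  z = pi_ a -> g = pi_ b -> [~ b, ell z^-1] = [~ a, ell g^-1].
Proof.
case/centerP=> zP zC gP aB bB Ez Eg.
have E : a * b ^ ell z^-1 = b * a ^ ell g^-1.
  have bA : b ^ ell z^-1 \in A by rewrite (O_in (O_stable bB _)) // groupV (Q_in zP).
  have aA : a ^ ell g^-1 \in A by rewrite (O_in (O_stable aB _)) // groupV (Q_in gP).
  apply: pi_inj; [by rewrite groupM ?(O_in aB) | by rewrite groupM ?(O_in bB) |].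
  rewrite (pi_M a) (pi_M b) -Ez -Eg -!conjgM -!ell_M !mulVg ell_1 !conjg1 -Ez -Eg.
  exact: zC.
rewrite !commgEl; apply: (mulgI a); apply: (mulgI b).
by rewrite (mulKVg a) -E (mulgA b) (add_grpC (O_in bB) (O_in aB)) -(mulgA a) mulKVg.
Qed.

(** [central_comm] turns a commutator of [b] with a power of [y] into one of an element of [W z]
    with an element of P. *)
Lemma W_descent z y : z \in 'Z(P) -> y \in 'Z(P) -> y \in pigrp (W z) ->
  W y \subset [~: W z, ell @* P].
Proof.
move=> zZ yZ yW; rewrite gen_subG; apply/subsetP=> _ /imset2P[b _ bB /cycleP[k ->] ->].
rewrite -morphX ?inE // -[y ^+ k]invgK.
set u := (y ^+ k)^-1.
have uZ : u \in 'Z(P) by rewrite groupV groupX.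
have [a aW Eu] : exists2 a, a \in W z & u = pi_ a.
  by apply: (pigrpP (W_brace zZ)); rewrite groupV groupX.
have aB : a \in B.
  by apply: (subsetP (comg_sub p _) a aW); apply: (subsetP (center_sub _)).
rewrite (central_comm uZ (mem_pigrp bB) aB bB Eu (erefl _)).
by rewrite mem_commg // mem_morphim ?inE // groupV mem_pigrp.
Qed.

(** B and the image of P generate a p-group, which is nilpotent. *)
Lemma W_proper z : z \in 'Z(P) -> W z :!=: 1 -> [~: W z, ell @* P] \proper W z.
Proof.
move=> zZ W1; apply: (@nil_comm_properl _ (B <*> ell @* P)%G) W1 _.
- apply: (pgroup_nil (p := p)); rewrite /= norm_joinEr ?ellP_norm // pgroupM.
  by rewrite pcore_pgroup morphim_pgroup // P_pgroup.
- apply: subset_trans (joing_subl _ _); apply: comg_sub.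
  exact: (subsetP (center_sub _)).
by rewrite subsetI joing_subr comg_stable.
Qed.

Lemma W_neq1 z : z \in P -> z != 1 -> W z :!=: 1.
Proof.
move=> zP; apply: contraNneq => /trivgP W1; apply/eqP.
apply: faithful_B (Q_in zP) _; rewrite -sub1set -gen_subG -/(cycle _).
by rewrite centsC; apply/commG1P/trivgP.
Qed.

Lemma central_order_p (K : {group {perm X}}) : K <| P -> K :!=: 1 ->
  exists2 z, z \in K & z \in 'Z(P) /\ #[z] = p.
Proof.
move=> nK K1; have nilP := pgroup_nil P_pgroup.
have pKZ : p.-group (K :&: 'Z(P)).
  exact: pgroupS (subset_trans (subsetIr _ _) (center_sub _)) P_pgroup.
have [_ pd _] := pgroup_pdiv pKZ (meet_center_nil nilP nK K1).
have [z + oz] := Cauchy p_pr pd; case/setIP=> zK zZ.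
by exists z.
Qed.

Lemma P_neq1 : P :!=: 1.
Proof.
have [x _] : exists x, x \in [set: X].
  by apply/card_gt0P; rewrite cardsT cardX expn_gt0 prime_gt0.
have := dvdn_orbit 'P P x; rewrite (atransP P_trans) ?inE // cardsT cardX.
apply: contraTneq => ->; rewrite cards1 dvdn1 -(expn0 p) eqn_exp2l //.
exact: prime_gt1.
Qed.

Lemma minimal_central : exists2 z, z \in 'Z(P) /\ #[z] = p &
  forall y, y \in 'Z(P) -> #[y] = p -> #|W z| <= #|W y|.
Proof.
have [z0 _ [z0Z oz0]] := central_order_p (normal_refl _) P_neq1.
pose S := [pred y | (y \in 'Z(P)) && (#[y] == p)].
have S0 : S z0 by rewrite /= z0Z oz0 eqxx.
case: (arg_minnP (fun y => #|W y|) S0) => z /andP[zZ /eqP oz] minz.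
by exists z => // y yZ oy; apply: minz; rewrite /= yZ oy eqxx.
Qed.

(** * A central element of order p and its blocks *)

Section Central.

Variable z : {perm X}.
Hypothesis zZ : z \in 'Z(P).
Hypothesis oz : #[z] = p.
Hypothesis minz : forall y, y \in 'Z(P) -> #[y] = p -> #|W z| <= #|W y|.
Variable x0 : X.

Lemma zP : z \in P. Proof. exact: (subsetP (center_sub _)). Qed.

Lemma z_comm g : g \in P -> commute z g.
Proof. by case/centerP: zZ => _; apply. Qed.

Lemma zX_perm k g x : g \in P -> g ((z ^+ k) x) = (z ^+ k) (g x).
Proof. by move=> gP; rewrite -!permM (commuteX k (commute_sym (z_comm gP))). Qed.

(** Powers of [z] commute with the transitive group P, so one fixed point forces all points to be
    fixed. *)
Lemma zX_fix k x : (z ^+ k) x = x -> z ^+ k = 1.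
Proof.
move=> E; apply/permP=> y; rewrite perm1; have [g gP ->] := P_transP x y.
by rewrite -zX_perm ?E.
Qed.

(** This is the stabilizer in P of the z-orbit of [x0]. It has index p in a p-group, so it is normal
    and preserves every z-orbit, see [N_orbit]. *)
Definition blockker : {group {perm X}} := ('C_P[x0 | 'P] <*> <[z]>)%G.
Local Notation N := blockker.

Lemma N_sub : N \subset P.
Proof. by rewrite join_subG subsetIl cycle_subG zP. Qed.

Lemma card_N : (p * #|N|)%N = #|P|.
Proof.
have zC : <[z]> \subset 'C('C_P[x0 | 'P]).
  rewrite cycle_subG; apply: (subsetP (centS (subsetIl P 'C[x0 | 'P]))).
  by case/setIP: zZ.
rewrite /= cent_joinEr // TI_cardMg; last first.
  apply/trivgP/subsetP=> y /setIP[/setIP[_ /astab1P E] /cycleP[k Ek]].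
  by rewrite inE Ek (@zX_fix k x0) // -Ek.
rewrite -orderE oz mulnCA mulnn mulnC -cardX -cardsT -(atransP P_trans x0) ?inE //.
exact: card_orbit_stab.
Qed.

Lemma N_index : #|P : N| = p.
Proof. by rewrite -divgS ?N_sub // -card_N mulnK. Qed.

Lemma N_max : maximal N P.
Proof. by apply: p_index_maximal N_sub _; rewrite N_index. Qed.

Lemma N_normal : N <| P.
Proof. exact: p_maximal_normal P_pgroup N_max. Qed.

Lemma N_orbit n x : n \in N -> exists k, n x = (z ^+ k) x.
Proof.
have [g gP ->] := P_transP x0 x => nN.
have : n ^ g^-1 \in N by rewrite memJ_norm // groupV (subsetP (normal_norm N_normal)).
rewrite {1}/blockker /= norm_joinEl; last first.
  apply: cents_norm; rewrite centsC cycle_subG.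
  apply: (subsetP (centS (subsetIl P 'C[x0 | 'P]))); by case/setIP: zZ.
case/mulsgP=> c _ /setIP[_ /astab1P E] /cycleP[k ->] Ek; exists k.
have -> : n = g^-1 * (c * z ^+ k) * g by rewrite -Ek conjgE invgK !mulgA mulVg mul1g mulgKV.
rewrite !permM permK; rewrite /= apermE in E; rewrite E.
exact: zX_perm.
Qed.

Lemma N_of g x k : g \in P -> g x = (z ^+ k) x -> g \in N.
Proof.
have N0 h : h \in P -> h x0 = (z ^+ k) x0 -> h \in N.
  move=> hP E; rewrite -[h](mulgKV (z ^+ k)) groupM //; last first.
    by apply: (subsetP (joing_subr _ _)); apply: mem_cycle.
  apply: (subsetP (joing_subl _ _)); rewrite inE groupM ?groupV ?groupX ?zP //=.
  by apply/astab1P; rewrite /= apermE permM E permK.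
have [h hP ->] := P_transP x0 x => gP E.
have : g ^ h^-1 \in N.
  apply: N0; first by rewrite groupJ ?groupV.
  by rewrite conjgE invgK !permM E zX_perm ?groupV // permK.
by rewrite memJ_norm // groupV (subsetP (normal_norm N_normal)).
Qed.

(** On each z-orbit the elements of N act as powers of [z]. *)
Lemma N_abelian : abelian N.
Proof.
apply/centsP=> n nN m mN; apply/permP=> x; rewrite !permM.
have [k Ek] := N_orbit x nN; have [l El] := N_orbit x mN.
rewrite Ek El !zX_perm ?(subsetP N_sub) // Ek El -!permM -!expgD addnC //.
Qed.

(* [O w] modulo [O w, z] is generated by elements indexed by the z-orbits, all of
   which are fixed by N. *)
Lemma N_comm w : [~: O w, ell @* N] \subset comg w z.
Proof.
rewrite gen_subG; apply/subsetP=> _ /imset2P[b _ bO /morphimP[n _ nN ->] ->].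
suffices /(_ b) : {in O w, forall b, b \in A /\ [~ b, ell n] \in comg w z}.
  by case.
rewrite transl_part_gen; apply: gen_ind => [|a c [aA Ha] [cA Hc]|_ /imsetP[x _ ->]].
- by rewrite group1 comm1g group1.
- split; first by rewrite groupM.
  have HA : [~ a, ell n] \in A.
    by apply: (subsetP (hall_sub w)); apply: (subsetP (comg_sub w zP)).
  rewrite commMgJ conjgE (add_grpC HA cA) mulKg groupM //.
split; first exact: O_in (transl_part_in w x).
have [k Ek] := N_orbit x nN.
(* On this generator [n] acts as [z ^+ k] does. *)
rewrite commgEl transl_part_conj ?(Q_in (subsetP N_sub _ nN)) // Ek.
rewrite -transl_part_conj ?groupX ?(Q_in zP) // -commgEl; apply: mem_comg; exact: transl_part_in.
Qed.

Local Notation V := (pigrp (W z)).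

Lemma W_sub_B : W z \subset B.
Proof. exact: (comg_sub p zP). Qed.

Lemma V_sub : V \subset P. Proof. exact: (pigrpS W_sub_B). Qed.

Lemma V_P g : g \in V -> exists2 a, a \in W z & g = pi_ a.
Proof. exact: (pigrpP (W_brace zZ)). Qed.

(* By [W_descent], a central element of [pigrp (W z)] would contradict the minimality
   of z. *)
Lemma V_noncentral y : y \in 'Z(P) -> #[y] = p -> y \notin V.
Proof.
move=> yZ oy; apply/negP=> yV.
have W1 : W z :!=: 1.
  by apply: W_neq1 zP _; rewrite -order_gt1 oz prime_gt1.
have := proper_card (sub_proper_trans (W_descent zZ yZ yV) (W_proper zZ W1)).
by rewrite ltnNge minz.
Qed.

Lemma N_act_B n b : n \in N -> b \in B -> [~ b, ell n] \in W z.
Proof.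
move=> nN bB; apply: (subsetP (N_comm p)).
by rewrite mem_commg // mem_morphim ?inE.
Qed.

(** If V lies in N, it acts trivially on B / W, and [pi_star] shows that V itself is normal.
    Otherwise N V = P; N is abelian, and V normalizes N. *)
Lemma V_N_normal : V :&: N <| P.
Proof.
rewrite /normal subIset ?V_sub //=.
have [sVN | sVN] := boolP (V \subset N).
  rewrite (setIidPl sVN); apply/subsetP=> g /QP[b bB ->].
  rewrite inE; apply/subsetP=> _ /imsetP[v vV ->].
  have vN := subsetP sVN v vV; have vP := subsetP V_sub v vV.
  have [a aW Ev] := V_P vV; have aB := subsetP W_sub_B a aW.
  have uW := N_act_B vN bB.
  have st := pi_star (O_in bB) (O_in aB).
  have Eb : b ^ ell (pi_ a) = b * [~ b, ell v] by rewrite commgEl mulKVg Ev.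
  rewrite Eb (pi_M b) -Ev in st.
  have -> : v ^ pi_ b = pi_ (a ^ ell (pi_ b)) * (pi_ ([~ b, ell v] ^ ell (pi_ b)))^-1.
    by rewrite conjgE; apply: (mulgI (pi_ b)); rewrite !mulgA mulgV mul1g st !mulgA mulgK.
  have bP : pi_ b \in P by rewrite mem_pigrp.
  by rewrite groupM ?groupV //; apply: mem_pigrp; apply: ellP_act (comg_stable p zZ) _.
have VN : (N * V)%g = P :> {set _} := mulg_normal_maximal N_normal N_max V_sub sVN.
rewrite -{1}VN; apply: mul_subG.
  apply: cents_norm; apply: subset_trans N_abelian _; apply: centS; exact: subsetIr.
apply: normsI; first exact: normG.
exact: subset_trans V_sub (normal_norm N_normal).
Qed.

Lemma V_N_TI : V :&: N = 1.
Proof.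
apply/eqP/idPn => VN1.
have [y /setIP[yV _] [yZ oy]] := @central_order_p (V :&: N)%G V_N_normal VN1.
by have := V_noncentral yZ oy; rewrite yV.
Qed.

Lemma N_V_P : N * V = P.
Proof.
apply: mulg_normal_maximal N_normal N_max V_sub _.
apply/negP=> /setIidPl VN.
have : W z :!=: 1 by apply: W_neq1 zP _; rewrite -order_gt1 oz prime_gt1.
by rewrite trivg_card1 -(card_pigrp (W_brace zZ)) -VN V_N_TI cards1 eqxx.
Qed.

Lemma card_V : #|V| = p.
Proof.
have := TI_cardMg (etrans (setIC _ _) V_N_TI); rewrite N_V_P -card_N mulnC => /eqP.
by rewrite eqn_pmul2l // => /eqP.
Qed.

Lemma card_W : #|W z| = p. Proof. by rewrite -(card_pigrp (W_brace zZ)) card_V. Qed.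

Lemma W_fixed a g : a \in W z -> g \in P -> a ^ ell g = a.
Proof.
move=> aW gP; have W1 : W z :!=: 1.
  by apply: W_neq1 zP _; rewrite -order_gt1 oz prime_gt1.
have pr := W_proper zZ W1.
have C1 : [~: W z, ell @* P] = 1.
  apply: card1_trivg; apply/eqP; have := cardSg (proper_sub pr).
  have := proper_card pr; rewrite card_W => lt /(primeP p_pr).2 /orP[//|/eqP E].
  by rewrite E ltnn in lt.
have : [~ a, ell g] \in [~: W z, ell @* P] by rewrite mem_commg // mem_morphim ?inE.
by rewrite C1 => /set1P ag; apply/conjg_fixP/eqP.
Qed.

(** * The regular action of sigma and z *)

Definition transl_p x := transl_part p x.
Definition s_p x := pi_ (transl_p x).

Lemma transl_p_in x : transl_p x \in B. Proof. exact: transl_part_in. Qed.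

Lemma s_p_in x : s_p x \in P. Proof. by apply: mem_pigrp; apply: transl_part_in. Qed.

Lemma transl_p_conj x g : g \in P -> transl_p x ^ ell g = transl_p (g x).
Proof. by move=> gP; apply: transl_part_conj (Q_in gP). Qed.

Definition wz := [~ transl_p x0, ell z].

Lemma wz_in : wz \in W z.
Proof. by have := mem_comg z 1 (transl_p_in x0); rewrite expg1. Qed.

(** P is transitive and fixes [wz], so the increment along [z] is the same at every point. *)
Lemma transl_p_z x : transl_p (z x) = transl_p x * wz.
Proof.
have [g gP ->] := P_transP x0 x.
rewrite -(W_fixed wz_in gP) -[z (g x0)](zX_perm 1 x0 gP) expg1 -!transl_p_conj ?zP //.
by rewrite -conjMg /wz commgEl mulKVg.
Qed.

Lemma act_B_triv g : g \in P -> (forall x, transl_p (g x) = transl_p x) -> g = 1.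
Proof.
move=> gP gmu; apply: faithful_B (Q_in gP) _.
rewrite transl_part_gen cent_gen; apply/centP=> _ /imsetP[x _ ->].
by apply/commute_sym/commgP/conjg_fixP; rewrite -/(transl_p x) transl_p_conj ?gmu.
Qed.

Lemma wz_neq1 : wz != 1.
Proof.
apply/eqP=> w1; have : z = 1.
  by apply: (act_B_triv zP) => x; rewrite transl_p_z w1 mulg1.
by move/eqP; rewrite -order_eq1 oz eqn_leq leqNgt prime_gt1.
Qed.

Lemma W_cycle : W z = <[wz]> :> {set _}.
Proof.
apply/eqP; rewrite eq_sym eqEcard cycle_subG wz_in card_W -orderE.
have : #[wz] %| p by have := order_dvdG wz_in; rewrite card_W.
case/(primeP p_pr).2/orP => /eqP E; last by rewrite E leqnn.
by have := wz_neq1; rewrite -order_eq1 E.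
Qed.

Definition sigma := pi_ wz.

Lemma sigma_V : sigma \in V. Proof. exact: mem_pigrp wz_in. Qed.
Lemma sigma_P : sigma \in P. Proof. exact: subsetP V_sub _ sigma_V. Qed.

Lemma pi_wX k : pi_ (wz ^+ k) = sigma ^+ k.
Proof.
elim: k => [|k IH]; first by rewrite pi_1.
by rewrite !expgS (pi_M wz) W_fixed ?IH // ?groupX ?wz_in ?sigma_P.
Qed.

Lemma order_wz : #[wz] = p. Proof. by rewrite orderE -W_cycle card_W. Qed.

Lemma sigma_neq1 : sigma != 1.
Proof.
apply/eqP=> s1; case/eqP: wz_neq1; apply: pi_inj; rewrite ?pi_1 ?group1 //.
by apply: (subsetP (hall_sub p)); apply: (subsetP W_sub_B); exact: wz_in.
Qed.

Lemma order_sigma : #[sigma] = p.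
Proof.
have : #[sigma] %| p by have := order_dvdG sigma_V; rewrite card_V.
case/(primeP p_pr).2/orP => /eqP // E.
by have := sigma_neq1; rewrite -order_eq1 E.
Qed.

Lemma V_cycle : V = <[sigma]> :> {set _}.
Proof. by apply/eqP; rewrite eq_sym eqEcard cycle_subG sigma_V /= card_V -orderE order_sigma. Qed.

Lemma s_p_z x : s_p (z x) = s_p x * sigma.
Proof. by rewrite /s_p transl_p_z (pi_M (transl_p x)) (W_fixed wz_in (s_p_in x)). Qed.

Lemma s_p_zX k x : s_p ((z ^+ k) x) = s_p x * sigma ^+ k.
Proof.
elim: k => [|k IH]; first by rewrite perm1 mulg1.
by rewrite !expgSr permM s_p_z IH mulgA.
Qed.

(** This is [pi_star] for [wz] and [transl_p x], as P fixes [wz]; it makes [sigma] an automorphism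
    of the p-part. *)
Lemma s_p_sigma x : s_p (sigma x) = s_p x ^ sigma.
Proof.
have wA : wz \in A by apply: (subsetP (hall_sub p)); apply: (subsetP W_sub_B); exact: wz_in.
have := pi_star wA (O_in (transl_p_in x)).
rewrite -/(s_p x) -/sigma (W_fixed wz_in (s_p_in x)) transl_p_conj ?sigma_P // -/(s_p _) => E.
by rewrite conjgE -E mulKg.
Qed.

Lemma s_p_sigmaX k x : s_p ((sigma ^+ k) x) = s_p x ^ (sigma ^+ k).
Proof.
elim: k => [|k IH]; first by rewrite perm1 conjg1.
by rewrite !expgSr permM s_p_sigma IH conjgM.
Qed.

Lemma sigma_zX k l : commute (sigma ^+ k) (z ^+ l).
Proof. by apply/commuteX2/commute_sym/z_comm/sigma_P. Qed.

(** P = N V, where N moves points along z-orbits and V is generated by [sigma]. With [E_free] this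
    gives regularity. *)
Lemma E_trans x y : exists k l, y = (sigma ^+ k) ((z ^+ l) x).
Proof.
have [g gP ->] := P_transP x y; move: gP.
rewrite -[_ \in _]/(g \in (P : {set _})) -N_V_P => /mulsgP[n v nN + ->].
rewrite [_ \in _]/(v \in (V : {set _})) V_cycle => /cycleP[k ->].
by have [l El] := N_orbit x nN; exists k, l; rewrite permM El.
Qed.

Lemma sigmaX_N k : sigma ^+ k \in N -> sigma ^+ k = 1.
Proof.
by move=> kN; apply/set1P; rewrite -[[set 1]]V_N_TI inE kN groupX // sigma_V.
Qed.

Lemma E_comm i j k l : commute (z ^+ j * sigma ^+ i) (z ^+ l * sigma ^+ k).
Proof.
have zz a b : commute (z ^+ a) (z ^+ b) by apply/commuteX2/commute_refl.
have ss a b : commute (sigma ^+ a) (sigma ^+ b) by apply/commuteX2/commute_refl.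
have cz := commuteM (zz j l) (commute_sym (sigma_zX k j)).
have cs := commuteM (sigma_zX i l) (ss i k).
exact: commute_sym (commuteM (commute_sym cz) (commute_sym cs)).
Qed.

Lemma E_free k l x : (sigma ^+ k) ((z ^+ l) x) = x -> sigma ^+ k = 1 /\ z ^+ l = 1.
Proof.
move=> E; have k1 : sigma ^+ k = 1.
  have : (z ^+ l)^-1 \in <[z]> by rewrite groupV mem_cycle.
  case/cycleP=> l' El; apply: sigmaX_N.
  apply: (@N_of (sigma ^+ k) ((z ^+ l) x) l'); first by rewrite groupX ?sigma_P.
  by rewrite E -El permK.
by move: E; rewrite k1 perm1 => E; split=> //; apply: zX_fix E.
Qed.

(** Moving [x0] by powers of [z] multiplies [s_p x0] by powers of [sigma], so its V-component can be
    cancelled. *)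
Lemma base_point : exists x1, s_p x1 \in N.
Proof.
have := s_p_in x0; rewrite -[_ \in _]/(s_p x0 \in (P : {set _})) -N_V_P => /mulsgP[n v nN + Em].
rewrite [_ \in _]/(v \in (V : {set _})) V_cycle => /cycleP[k Ev].
(* As p - 1 is -1 modulo p, the exponent stands for -k. *)
exists ((z ^+ (k * p.-1)) x0); rewrite s_p_zX Em Ev -mulgA -expgD.
rewrite -{1}[k]muln1 -mulnDr add1n prednK ?prime_gt0 // mulnC expgM -order_sigma.
by rewrite expg_order expg1n mulg1.
Qed.

(** Modulo N, [s_p] determines the z-exponent. So two points with equal [transl_p] differ by a power
    of [sigma]; it commutes with the transitive group <sigma, z>, hence preserves [transl_p]
    everywhere and is trivial. *)
Lemma transl_p_inj : injective transl_p.
Proof.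
have [x1 mN] := base_point.
move=> x y Exy.
have [i [j Ex]] := E_trans x1 x; have [i' [j' Ey]] := E_trans x1 y.
have mE a b : exists2 n, n \in N & s_p ((sigma ^+ a) ((z ^+ b) x1)) = n * sigma ^+ b.
  have sgc : (sigma ^+ b) ^ (sigma ^+ a) = sigma ^+ b.
    by apply/conjg_fixP/commgP/commuteX2/commute_refl.
  exists (s_p x1 ^ sigma ^+ a); last by rewrite s_p_sigmaX s_p_zX conjMg sgc.
  by rewrite memJ_norm // (subsetP (normal_norm N_normal)) // groupX ?sigma_P.
have zj : z ^+ j = z ^+ j'.
  apply/eqP; rewrite eq_expg_mod_order oz -order_sigma -eq_expg_mod_order eq_mulgV1.
  have [n nN En] := mE i j; have [n' nN' En'] := mE i' j'.
  rewrite -Ex in En; rewrite -Ey in En'.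
  have E : n * sigma ^+ j = n' * sigma ^+ j' by rewrite -En -En' /s_p Exy.
  apply/eqP/set1P; rewrite -[[set 1]]V_N_TI inE groupM ?groupV ?groupX ?sigma_V //=.
  have -> : sigma ^+ j * (sigma ^+ j')^-1 = n^-1 * n'.
    by rewrite -[n'](mulgK (sigma ^+ j')) -E -mulgA mulKg.
  by rewrite groupM ?groupV.
set u := (sigma ^+ i)^-1 * sigma ^+ i'.
have uV : u \in V by rewrite groupM ?groupV ?groupX ?sigma_V.
have uP := subsetP V_sub u uV.
have Eyx : y = u x by rewrite Ey Ex -zj permM permK.
suffices u1 : u = 1 by rewrite Eyx u1 perm1.
apply: (act_B_triv uP) => x'; have [k [l ->]] := E_trans x x'.
set e := z ^+ l * sigma ^+ k.
have eP : e \in P by rewrite groupM ?groupX ?sigma_P ?zP.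
have eu : commute e u.
  move: uV; rewrite -[_ \in _]/(u \in (V : {set _})) V_cycle => /cycleP[c ->].
  apply/commute_sym; apply: commuteM; first exact: sigma_zX.
  exact/commuteX2/commute_refl.
have -> : (sigma ^+ k) ((z ^+ l) x) = e x by rewrite permM.
by rewrite -permM eu permM -!(transl_p_conj _ eP) -Eyx Exy.
Qed.

(** A permutation commuting with the transitive abelian group <sigma, z> belongs to it;
    [V_noncentral] removes the sigma-component. *)
Lemma center_P y : y \in 'Z(P) -> exists k, y = z ^+ k.
Proof.
move=> yZ; have yP := subsetP (center_sub _) y yZ.
have [k [l E]] := E_trans x0 (y x0).
have Ey : y = z ^+ l * sigma ^+ k.
  apply/permP=> x; have [i [j ->]] := E_trans x0 x.
  have /centerP[_ yC] := yZ.
  have -> : (sigma ^+ i) ((z ^+ j) x0) = (z ^+ j * sigma ^+ i) x0 by rewrite permM.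
  have eP : z ^+ j * sigma ^+ i \in P by rewrite groupM ?groupX ?sigma_P ?zP.
  rewrite -permM -(yC _ eP) permM E.
  have -> : (sigma ^+ k) ((z ^+ l) x0) = (z ^+ l * sigma ^+ k) x0 by rewrite permM.
  by rewrite -permM E_comm permM.
suffices k1 : sigma ^+ k = 1 by exists l; rewrite Ey k1 mulg1.
have kZ : sigma ^+ k \in 'Z(P).
  by rewrite -[sigma ^+ k](mulKg (z ^+ l)) -Ey groupM ?groupV ?groupX.
apply/eqP/idPn=> k1.
have ok : #[sigma ^+ k] = p.
  have : #[sigma ^+ k] %| p by rewrite -order_sigma orderXdvd.
  case/(primeP p_pr).2/orP => /eqP // ok.
  by move: k1; rewrite -order_eq1 ok.
by have := V_noncentral kZ ok; rewrite groupX // sigma_V.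
Qed.

(** * The p'-part *)

(* O_p' of the subgroup [PQ r] is trivial, so its minimal normal subgroups, which
   exist and are abelian by Burnside's theorem, lie in P and centralize [O r];
   each of them contains the center <z> of P. *)
Lemma z_cent_prime (r : nat) : prime r -> r != p -> ell z \in 'C(O r).
Proof.
move=> r_pr rp.
have pr : p \notin (r : nat_pred) by rewrite inE eq_sym.
have sPPQ : P \subset PQ r by rewrite PQ_mul mulG_subl.
have sol : solvable (PQ r).
  apply: Burnside_p_a_q_b.
  rewrite (@uniq_leq_size _ _ [:: p; r]) ?primes_uniq // => q.
  rewrite mem_primes => /and3P[q_pr _].
  rewrite PQ_mul TI_cardMg ?P_Q_TI // Euclid_dvdM // !inE.
  case/orP=> qd; first by have := pgroupP P_pgroup q q_pr qd; rewrite inE => ->.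
  by have := pgroupP (pHall_pgroup (pihall_Hall r)) q q_pr qd; rewrite inE orbC => ->.
have PQ1 : PQ r :!=: 1.
  by apply: contraNneq P_neq1 => PQ1; rewrite -subG1 -PQ1.
have [M minM sM] := minnormal_exists PQ1 (normG _).
have [nM M1 /is_abelemP[q q_pr /abelem_pgroup qM]] := minnormal_solvable minM sM sol.
have nMPQ : M <| PQ r by apply/andP.
have qp : q = p.
  apply/eqP; apply: contraNT M1 => qp; apply/eqP.
  apply: (p'normal_triv nMPQ); apply: sub_pgroup qM => u.
  by rewrite !inE => /eqP ->.
rewrite qp in qM.
have sylP : p.-Sylow(PQ r) P := pHall_subl sPPQ (PQ_sub r) (pihall_Hall p).
have MP : M \subset P.
  apply: subset_trans (pcore_sub_Hall sylP); exact: pcore_max.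
have [y yM [yZ oy]] := central_order_p (normalS MP sPPQ nMPQ) M1.
have yP := subsetP MP y yM.
have yC : ell y \in 'C(O r).
  apply/centP=> c cC; apply/commute_sym/commgP/conjg_fixP.
  have [b bB Ey] := QP yP; rewrite Ey.
  have [] // := conj_in_P pr bB cC.
  apply: (subsetP MP); rewrite -Ey memJ_norm //.
  by apply: (subsetP nM); rewrite PQ_mul (subsetP (mulG_subr _ _)) // mem_pigrp.
have [k Ek] := center_P yZ.
have : z \in <[y]>.
  have -> : <[y]> = <[z]>; last exact: cycle_id.
  by apply/eqP; rewrite eqEcard -!orderE oy oz leqnn andbT cycle_subG Ek mem_cycle.
by case/cycleP=> j ->; rewrite morphX ?inE // groupX.
Qed.

(** A_p' is generated by its Sylow subgroups, each trivial or contained in some A_r with r a prime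
    other than p. *)
Lemma z_cent : ell z \in 'C(O p^').
Proof.
rewrite -sub_cent1 -(Sylow_gen (O p^')).
rewrite gen_subG; apply/bigcupsP=> S /andP[/p_groupP[r r_pr rS] /andP[sSO _]].
have [rp | rp] := eqVneq r p.
  have p'S : p^'.-group S := pgroupS sSO (pcore_pgroup _ _).
  rewrite rp in rS; rewrite (card1_trivg (pnat_1 rS p'S)); exact: sub1G.
rewrite sub_cent1; apply: (subsetP (centS _) _ (z_cent_prime r_pr rp)).
rewrite (sub_normal_Hall (hall_Hall r)) ?pcore_normal //.
exact: subset_trans sSO (hall_sub _).
Qed.

(** [N_comm] applies to the p'-part, where [A_p', z] is trivial. *)
Lemma N_cent : N \subset act_cent p^'.
Proof.
apply/subsetP=> n nN; rewrite act_centE.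
apply/centP=> c cC; apply/commute_sym/commgP.
have W1 : comg p^' z = 1 :> {set _}.
  by apply/commG1P; rewrite centsC cycle_subG z_cent.
have : [~ c, ell n] \in comg p^' z.
  by apply: (subsetP (N_comm p^')); rewrite mem_commg // mem_morphim ?inE.
by rewrite -[_ \in _]/(_ \in (comg p^' z : {set _})) W1 inE.
Qed.

Lemma transl_p_conjG x g : g \in G -> transl_p x ^ ell g = transl_p (g x).
Proof. exact: transl_part_conj. Qed.

(** * The p'-part when N is normal in G *)

Section NormalN.

Hypothesis nNG : G \subset 'N(N).

Lemma W_stable_G q : q \in G -> wz ^ ell q \in W z.
Proof.
move=> qG; rewrite /wz conjRg transl_p_conjG // -morphJ ?inE //; apply: N_act_B (transl_p_in _).
rewrite memJ_norm ?(subsetP nNG) //.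
by apply: (subsetP (joing_subr _ _)); apply: cycle_id.
Qed.

(** Once this stabilizer of [wz] is trivial, [q] going to [wz ^ ell q] embeds the p'-part of G in
    the nontrivial elements of W, see [card_C_lt]. *)
Definition Qc : {group {perm X}} := (Q p^' :&: ell @*^-1 'C[wz])%G.

Lemma QcP q : (q \in Qc) = (q \in Q p^') && (wz ^ ell q == wz).
Proof.
rewrite in_setI; congr (_ && _); apply/morphpreP/eqP.
  by case=> _ /cent1P/commute_sym/commgP/conjg_fixP.
move/conjg_fixP/commgP/commute_sym=> qw; split; first exact: in_setT.
exact/cent1P.
Qed.

Lemma Qc_z q : q \in Qc -> commute q z.
Proof.
rewrite QcP => /andP[/Q_in qG /eqP wq]; apply/permP=> x; rewrite !permM.
by apply: transl_p_inj; rewrite transl_p_z -!(transl_p_conjG _ qG) transl_p_z conjMg wq.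
Qed.

Lemma Qc_sigma : sigma \in 'N(Qc).
Proof.
rewrite inE; apply/subsetP=> _ /imsetP[q + ->].
rewrite !QcP => /andP[/QP[c cC ->] /eqP wq].
have sgG := Q_in sigma_P.
have wA : wz \in A by apply: O_in; apply: (subsetP W_sub_B); exact: wz_in.
have := pi_star wA (O_in cC); rewrite wq -/sigma => E.
have -> : pi_ c ^ sigma = pi_ (c ^ ell sigma) by rewrite conjgE -E mulKg.
rewrite mem_pigrp ?O_stable //=.
have <- : pi_ c ^ sigma = pi_ (c ^ ell sigma) by rewrite conjgE -E mulKg.
have wsg : wz ^ ell sigma = wz by apply: W_fixed wz_in sigma_P.
have wsgV : wz ^ ell sigma^-1 = wz by apply: (W_fixed wz_in); rewrite groupV sigma_P.
by rewrite (conjgE (pi_ c)) !ell_M !conjgM wsgV wq wsg.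
Qed.

(* The orbits of <Qc, z> have p-power length dividing p |Qc|, so they are z-orbits;
   since Qc commutes with z, it acts on each of them as a power of z. *)
Lemma Qc_triv : Qc :=: 1.
Proof.
have p'Q : p^'.-group Qc := pgroupS (subsetIl _ _) (pHall_pgroup (pihall_Hall p^')).
have cQz : <[z]> \subset 'C(Qc).
  by rewrite cycle_subG; apply/centP=> q /Qc_z.
pose K := (Qc <*> <[z]>)%G; pose L := (K <*> <[sigma]>)%G.
have nKL : K <| L.
  rewrite /normal joing_subl join_subG normG cycle_subG /=.
  have : <[sigma]> \subset 'N(K).
    apply: normsY; first by rewrite cycle_subG Qc_sigma.
    apply: cents_norm; rewrite cent_cycle cycle_subG.
    exact/cent1P/commute_sym/z_comm/sigma_P.
  by rewrite cycle_subG.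
have zL : z \in L.
  by apply: (subsetP (joing_subl _ _)); apply: (subsetP (joing_subr _ _)); exact: cycle_id.
have sgL : sigma \in L by apply: (subsetP (joing_subr _ _)); exact: cycle_id.
have trL : [transitive L, on [set: X] | 'P].
  apply/imsetP; exists x0; rewrite ?inE //; apply/esym/eqP; rewrite eqEsubset subsetT.
  apply/subsetP=> y _; have [k [l ->]] := E_trans x0 y.
  by apply/orbitP; exists (z ^+ l * sigma ^+ k); rewrite ?groupM ?groupX //= apermE permM.
have cardK : #|K| = (#|Qc| * p)%N.
  rewrite /= cent_joinEr // coprime_cardMg -?orderE ?oz //.
  by rewrite coprime_sym; apply: (@pnat_coprime p) => //; exact: pnat_id.
have orbz x : #|orbit 'P <[z]> x| = p.
  have := card_orbit_stab 'P <[z]>%G x; rewrite [X in _ = X](_ : _ = p); last exact: oz.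
  rewrite (_ : 'C_(<[z]>)[x | 'P] = 1) ?cards1 ?muln1 //.
  apply/trivgP/subsetP=> y /setIP[/cycleP[k ->] /astab1P E].
  by rewrite inE (@zX_fix k x).
have orbK x : orbit 'P K x = orbit 'P <[z]> x.
  apply/eqP; rewrite eq_sym eqEcard; apply/andP; split.
    by apply: imsetS; apply: joing_subr.
  rewrite orbz; have pX : p.-nat #|orbit 'P K x|.
    by apply: pnat_dvd (normal_orbit_dvd x trL nKL) _; rewrite cardX pnatX pnat_id.
  have : #|orbit 'P K x| %| #|K| by apply: dvdn_orbit.
  rewrite cardK Gauss_dvdr; last exact: pnat_coprime pX p'Q.
  exact: dvdn_leq (prime_gt0 p_pr).
apply/trivgP/subsetP=> q qQ; rewrite inE.
have qz := Qc_z qQ.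
have qX n x k : q x = (z ^+ k) x -> (q ^+ n) x = (z ^+ (k * n)) x.
  move=> E; elim: n => [|n IH]; first by rewrite muln0.
  rewrite expgSr permM IH -permM -(commuteX (k * n) qz) permM E -permM -expgD.
  by rewrite mulnS.
have qp : q ^+ p = 1.
  apply/permP=> x; rewrite perm1.
  have : q x \in orbit 'P K x.
    by apply/orbitP; exists q => //; apply: (subsetP (joing_subl _ _)).
  rewrite orbK => /orbitP[_ /cycleP[k ->] /= E].
  rewrite (@qX p x k) // mulnC expgM -oz expg_order expg1n perm1 //.
rewrite -order_eq1; apply/eqP; apply: (@pnat_1 p).
  by apply: (@pnat_dvd _ p); rewrite ?order_dvdn ?qp ?pnat_id.
exact: mem_p_elt p'Q qQ.
Qed.

Lemma card_C_lt : #|O p^'| < p.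
Proof.
rewrite -(card_pigrp (hall_sub_brace p^')).
have inj : {in Q p^' &, injective (fun q => wz ^ ell q)}.
  move=> q q' qQ q'Q E; apply/eqP; rewrite eq_mulgV1; apply/eqP/set1P.
  rewrite -[[set 1]]Qc_triv QcP groupM ?groupV //=.
  by rewrite ell_M conjgM E -conjgM -ell_M mulgV ell_1 conjg1.
rewrite -(card_in_imset inj) -{2}card_W (cardsD1 1 (W z)) group1 ltnS.
apply: subset_leq_card; apply/subsetP=> _ /imsetP[q qQ ->].
by rewrite !inE conjg_eq1 wz_neq1 W_stable_G // (Q_in qQ).
Qed.

(** P-orbits on A_p' have p-power length, and this length is below p by [card_C_lt]. *)
Lemma small_C_cent : P \subset act_cent p^'.
Proof.
apply/subsetP=> g gP; rewrite act_centE; apply/centP=> c cC.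
apply/commute_sym/commgP/conjg_fixP.
have cl : c ^: (ell @* P) \subset O p^'.
  by apply/subsetP=> _ /imsetP[_ /morphimP[h _ hP ->] ->]; apply: O_stable (Q_in hP).
have lt := leq_ltn_trans (subset_leq_card cl) card_C_lt.
have pcl : p.-nat #|c ^: (ell @* P)|.
  rewrite -index_cent1; apply: pnat_dvd (dvdn_indexg _ _) _.
  exact: (morphim_pgroup _ P_pgroup).
have c1 : #|c ^: (ell @* P)| = 1%N.
  have /p_natP[[|k] //] := pcl => E; move: lt; rewrite E ltnNge.
  by rewrite expnS leq_pmulr // expn_gt0 prime_gt0.
have /cards1P[d Ed] : #|c ^: (ell @* P)| == 1%N by apply/eqP.
have : c ^ ell g \in c ^: (ell @* P) by rewrite memJ_class // mem_morphim ?inE.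
have := class_refl (ell @* P) c.
by rewrite Ed !inE => /eqP-> /eqP.
Qed.

End NormalN.

(** The kernel D of P on A_p' contains N and is normalized by G = PQ. If D were not P, maximality of
    N would give D = N, and [small_C_cent] would apply. *)
Lemma P_cent : P \subset act_cent p^'.
Proof.
apply/idPn=> nPC; case/negP: (nPC).
pose D := (P :&: act_cent p^')%G.
have nDG : G \subset 'N(D).
  rewrite -PQ_G PQ_mul; apply: mul_subG; last exact: (act_cent_Q_norm p p^').
  by apply: normsI; [apply: normG | apply: subset_trans (Q_sub _) (act_cent_norm _)].
have DN : D :=: N.
  have /maxgroupP[_ maxN] := N_max; apply: maxN.
    by rewrite properE subsetIl subsetI subxx.
  by rewrite subsetI N_sub N_cent.
by apply: small_C_cent; rewrite -DN.
Qed.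

(** * Coordinates on X *)

Definition transl_p' := transl_part p^' x0.
Definition s_p' := pi_ transl_p'.

Lemma transl_p'_in : transl_p' \in O p^'. Proof. exact: transl_part_in. Qed.

Lemma s_p'_Q : s_p' \in Q p^'. Proof. exact: (mem_pigrp transl_p'_in). Qed.

Lemma s_p'_G : s_p' \in G. Proof. exact: Q_in s_p'_Q. Qed.

Lemma transl_p'_const x : transl_part p^' x = transl_p'.
Proof.
have [g gP ->] := P_transP x0 x; rewrite -transl_part_conj ?(Q_in gP) //.
apply/conjg_fixP/commgP/commute_sym; have := subsetP P_cent g gP.
by rewrite act_centE => /centP; apply; apply: transl_p'_in.
Qed.

(** P acts trivially on A_p', so [pi_M] maps the decomposition of [t x] into its two parts to a
    product in G. *)
Lemma s_decomp x : s x = s_p x * s_p'.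
Proof.
rewrite -pi_transl -[t x in LHS](consttC p) (pi_M (t x).`_p).
rewrite -/(transl_part p x) -/(transl_p x) -/(s_p x).
have := subsetP P_cent _ (s_p_in x); rewrite act_centE => /centP /(_ _ transl_p'_in) mc.
rewrite -/(transl_part p^' x) transl_p'_const.
by rewrite (_ : transl_p' ^ ell (s_p x) = transl_p') //; apply/conjg_fixP/commgP.
Qed.

Lemma pi_s_p' b : b \in B -> pi_ b ^ s_p' = pi_ (b ^ ell s_p').
Proof.
move=> bB; apply: (cent_conj bB transl_p'_in); rewrite -act_centE (subsetP P_cent) //.
exact: mem_pigrp.
Qed.

Lemma s_p'_norm g : g \in P -> g ^ s_p' \in P.
Proof.
by move=> /QP[b bB ->]; rewrite pi_s_p' // mem_pigrp // O_stable // s_p'_G.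
Qed.

Lemma s_p_s_p' x : s_p (s_p' x) = s_p x ^ s_p'.
Proof. by rewrite pi_s_p' ?transl_p_in // transl_p_conjG // s_p'_G. Qed.

Lemma s_p'_norm_P : s_p' \in 'N(P).
Proof. by rewrite inE; apply/subsetP=> _ /imsetP[g gP ->]; apply: s_p'_norm. Qed.

Lemma s_p'_act_conj (g : {perm X}) x : s_p' (g x) = (g ^ s_p') (s_p' x).
Proof. by rewrite -!permM conjgE mulKVg. Qed.

(** [s_p'] normalizes Z(P) = <z>, and its action maps [wz] into W = <wz>. Computing
    [transl_p (s_p' (z x0))] in two ways equates the exponents. *)
Lemma s_p'_power : exists t : nat, z ^ s_p' = z ^+ t /\ sigma ^ s_p' = sigma ^+ t.
Proof.
have zvZ : z ^ s_p' \in 'Z(P).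
  by rewrite memJ_norm // (subsetP (char_norms (center_char _))) // s_p'_norm_P.
have [k Ek] := center_P zvZ.
have wW : wz ^ ell s_p' \in W z.
  rewrite /wz conjRg transl_p_conjG ?s_p'_G // -morphJ ?inE // Ek.
  exact: (mem_comg z k (transl_p_in _)).
move: wW; rewrite -[_ \in _]/(_ \in (W z : {set _})) W_cycle => /cycleP[t Et].
exists t; split; last by rewrite pi_s_p' ?Et ?pi_wX //; apply: (subsetP W_sub_B); apply: wz_in.
have muX l x : transl_p ((z ^+ l) x) = transl_p x * wz ^+ l.
  elim: l => [|l IH]; first by rewrite perm1 mulg1.
  by rewrite (expgSr z) permM transl_p_z IH (expgSr wz) (mulgA (transl_p x)).
have : transl_p (s_p' x0) * wz ^+ k = transl_p (s_p' x0) * wz ^+ t.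
  by rewrite -muX -Ek -s_p'_act_conj -Et -!(transl_p_conjG _ s_p'_G) transl_p_z conjMg.
move/mulgI/eqP; rewrite eq_expg_mod_order order_wz -oz -eq_expg_mod_order => /eqP <-.
exact: Ek.
Qed.

Lemma N_s_p' n : n \in N -> n ^ s_p' \in N.
Proof.
move=> nN; have [k Ek] := N_orbit x0 nN; have [t [zv _]] := s_p'_power.
apply: (@N_of _ (s_p' x0) (t * k)); first exact: s_p'_norm (subsetP N_sub n nN).
by rewrite -s_p'_act_conj Ek s_p'_act_conj conjXg zv expgM.
Qed.

Lemma s_p_sigmaz i j x : s_p ((sigma ^+ i) ((z ^+ j) x)) = s_p x ^ (sigma ^+ i) * sigma ^+ j.
Proof.
have sgc : (sigma ^+ j) ^ (sigma ^+ i) = sigma ^+ j.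
  by apply/conjg_fixP/commgP/commuteX2/commute_refl.
by rewrite s_p_sigmaX s_p_zX conjMg sgc.
Qed.

Lemma N_sigmaJ n i : n \in N -> n ^ (sigma ^+ i) \in N.
Proof. by move=> nN; rewrite memJ_norm // (subsetP (normal_norm N_normal)) // groupX ?sigma_P. Qed.

(* s_p' acts on the sigma-orbit of a base point by an affine map i |-> t i + e; if
   t = 1 it is a translation of order prime to p, hence e = 0. *)
Lemma fixed_base : exists2 x, s_p x \in N & s_p' x = x.
Proof.
have [x1 mN] := base_point; have [t [zv sv]] := s_p'_power.
have [e [l El]] := E_trans x1 (s_p' x1).
(* [s_p x1] and its conjugate by [s_p'] lie in N, so [s_p_sigmaz] puts [sigma ^+ l] in N. *)
have l1 : sigma ^+ l = 1.
  apply: sigmaX_N; rewrite -[sigma ^+ l](mulKg (s_p x1 ^ sigma ^+ e)) -s_p_sigmaz -El s_p_s_p'.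
  by rewrite groupM ?groupV ?N_sigmaJ ?N_s_p'.
have {l1} zl1 : z ^+ l = 1.
  by apply/eqP; rewrite -(expg0 z) eq_expg_mod_order oz -order_sigma -eq_expg_mod_order l1.
rewrite zl1 perm1 in El.
have vX i : s_p' ((sigma ^+ i) x1) = (sigma ^+ (t * i + e)) x1.
  by rewrite s_p'_act_conj conjXg sv -expgM El -permM -expgD addnC.
suffices [i Ei] : exists i, (t * i + e = i %[mod p])%N.
  exists ((sigma ^+ i) x1); first by rewrite s_p_sigmaX N_sigmaJ.
  rewrite vX; congr (fun_of_perm _ x1).
  by apply/eqP; rewrite eq_expg_mod_order order_sigma; apply/eqP.
have [t1 | t1] := eqVneq (t%:R : 'F_p)%R 1%R.
  exists 0%N; rewrite muln0 add0n mod0n.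
  have sv1 : sigma ^ s_p' = sigma.
    rewrite sv -{2}[sigma]expg1; apply/eqP; rewrite eq_expg_mod_order order_sigma.
    by rewrite -!val_Fp_nat // t1.
  have vn n : (s_p' ^+ n) x1 = (sigma ^+ (n * e)) x1.
    elim: n => [|n IH]; first by rewrite mul0n.
    rewrite expgSr permM IH s_p'_act_conj conjXg sv1 El -permM -expgD.
    by rewrite mulSn addnC.
  (* Iterate as often as the order of [s_p'], which is prime to p. *)
  have : sigma ^+ (#[s_p'] * e) = 1.
    have := @E_free (#[s_p'] * e) 0 x1; rewrite expg0 perm1 -vn expg_order perm1.
    by case/(_ erefl).
  move/eqP; rewrite -order_dvdn order_sigma Euclid_dvdM // => /orP[pv|]; last by move/eqP.
  have := mem_p_elt (pHall_pgroup (pihall_Hall p^')) s_p'_Q.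
  by move/pgroupP/(_ p p_pr pv); rewrite inE /= inE eqxx.
(* The fixed point of i |-> t i + e. *)
pose i := (e%:R / (1 - t%:R) : 'F_p)%R.
exists i; have nz : (1 - t%:R != 0 :> 'F_p)%R by rewrite GRing.subr_eq0 eq_sym.
rewrite -!val_Fp_nat //; congr (nat_of_ord _).
rewrite GRing.natrD GRing.natrM natr_Zp.
by rewrite -[X in (_ + X)%R](divfK nz) -/i mulrBr mulr1 mulrC addrC subrK.
Qed.

(** [Th (k, l)] is sigma^k z^l applied to the base point of [fixed_base]. There [n0] shifts l by
    [h k], and [s_p'] scales both coordinates by [t]. *)
Lemma coordinates : exists (t : 'F_p) (h : 'F_p -> 'F_p) (Th : 'F_p * 'F_p -> X),
  [/\ t != 0%R, bijective Th,
      forall k, h (t * k)%R = (t * h k)%R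
    & forall i j k l, s (Th (i, j)) (Th (k, l)) =
        Th (t * (k + j), t * (l + h (k - i)))%R].
Proof.
have [x1 mN vx] := fixed_base; have [tn [zv sv]] := s_p'_power.
pose n0 := s_p x1.
have expFp g n : #[g : {perm X}] = p -> g ^+ (n%:R : 'F_p)%R = g ^+ n.
  by move=> og; rewrite val_Fp_nat // -og expg_mod_order.
have expD g (a b : 'F_p) : #[g : {perm X}] = p -> g ^+ (a + b)%R = g ^+ a * g ^+ b.
  move=> og; rewrite -expgD -(expFp g (a + b)%N og).
  by rewrite GRing.natrD !natr_Zp.
have expM g (a b : 'F_p) : #[g : {perm X}] = p -> g ^+ (a * b)%R = g ^+ (a * b).
  by move=> og; rewrite -(expFp g (a * b)%N og) GRing.natrM !natr_Zp.
pose t : 'F_p := (tn%:R)%R.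
have svt : sigma ^ s_p' = sigma ^+ t by rewrite sv expFp // order_sigma.
have zvt : z ^ s_p' = z ^+ t by rewrite zv expFp // oz.
pose Th (u : 'F_p * 'F_p) := (sigma ^+ u.1) ((z ^+ u.2) x1).
have ThS (i k l : 'F_p) : (sigma ^+ i) (Th (k, l)) = Th (k + i, l)%R.
  by rewrite /Th /= expD ?order_sigma // permM.
have ThZ (j k l : 'F_p) : (z ^+ j) (Th (k, l)) = Th (k, l + j)%R.
  by rewrite /Th /= -zX_perm ?groupX ?sigma_P // expD ?oz // permM.
have Th_inj : injective Th.
  case=> k l [k' l'] E.
  have : (sigma ^+ (k - k')%R) ((z ^+ (l - l')%R) (Th (0, 0)%R)) = Th (0, 0)%R.
    rewrite ThZ ThS !add0r.
    have := congr1 (fun x => (sigma ^+ (- k')%R) ((z ^+ (- l')%R) x)) E.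
    by rewrite !ThZ !ThS !subrr.
  case/E_free => k1 l1.
  have F0 g (a : 'F_p) : #[g : {perm X}] = p -> g ^+ a = 1 -> a = 0%R.
    move=> og /eqP; rewrite -order_dvdn og => /dvdnP[c Ec].
    by rewrite -[a]natr_Zp Ec GRing.natrM pchar_Fp_0 // mulr0.
  have /eqP := F0 _ _ order_sigma k1; have /eqP := F0 _ _ oz l1.
  by rewrite !subr_eq0 => /eqP-> /eqP->.
have Th_surj x : exists u, Th u = x.
  have [k [l ->]] := E_trans x1 x; exists (k%:R, l%:R)%R.
  by rewrite /Th /= !expFp ?order_sigma ?oz.
have Th_bij : bijective Th.
  have [f fK] := fin_all_exists Th_surj.
  by exists f => [u|x]; [apply: Th_inj; rewrite fK | rewrite fK].
have [h hE] : exists h : 'F_p -> 'F_p, forall k, n0 (Th (k, 0)%R) = Th (k, h k).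
  apply: (@fin_all_exists _ _ (fun k l => n0 (Th (k, 0)%R) = Th (k, l))) => k.
  have [l ->] := N_orbit (Th (k, 0)%R) mN; exists (l%:R)%R.
  by rewrite -(expFp z l oz) ThZ add0r.
have n0E k l : n0 (Th (k, l)) = Th (k, l + h k)%R.
  by rewrite -[l in LHS]add0r -(ThZ l k 0%R) zX_perm ?s_p_in // hE ThZ addrC.
have vE k l : s_p' (Th (k, l)) = Th (t * k, t * l)%R.
  rewrite /Th /= s_p'_act_conj conjXg svt s_p'_act_conj conjXg zvt vx.
  by rewrite !expM ?order_sigma ?oz // !expgM.
have t0 : t != 0%R.
  apply/eqP=> t0; move: svt; rewrite t0 expg0 => /eqP.
  by rewrite conjg_eq1 (negPf sigma_neq1).
exists t, h, Th; split=> // [k|i j k l].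
  (* [n0] commutes with [s_p'], because [s_p'] fixes [x1]. *)
  have : n0 (s_p' (Th (k, 0)%R)) = s_p' (n0 (Th (k, 0)%R)).
    by rewrite s_p'_act_conj /n0 -s_p_s_p' vx.
  rewrite hE !vE mulr0 hE => /Th_inj[].
  by [].
rewrite s_decomp permM.
have mE : s_p (Th (i, j)) = n0 ^ (sigma ^+ i) * sigma ^+ j by apply: s_p_sigmaz.
rewrite mE permM conjgE !permM.
have -> : (sigma ^+ i)^-1 (Th (k, l)) = Th (k - i, l)%R.
  by apply: (canLR (permK _)); rewrite ThS subrK.
by rewrite n0E !ThS vE subrK.
Qed.

End Central.

Lemma prime_square_coordinates :
  exists (t : 'F_p) (h : 'F_p -> 'F_p) (Th : 'F_p * 'F_p -> X),
  [/\ t != 0%R, bijective Th,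
      forall k, h (t * k)%R = (t * h k)%R
    & forall i j k l, s (Th (i, j)) (Th (k, l)) =
        Th (t * (k + j), t * (l + h (k - i)))%R].
Proof.
have [x0 _] : exists x, x \in [set: X].
  by apply/card_gt0P; rewrite cardsT cardX expn_gt0 prime_gt0.
have [z [zZ oz] minz] := minimal_central.
exact: coordinates zZ oz minz x0.
Qed.

End PrimeSquare.

End CycleSet.

End PermutationGroups.

Local Open Scope ring_scope.

(** * The explicit families *)

Section LambdaFamilies.

Lemma pair_eq_inv (T U : Type) (a a' : T) (b b' : U) :
  (a, b) = (a', b') -> a = a' /\ b = b'.
Proof. by case. Qed.

(* The conditions on l under which [map_of_lambda l] is a solution; in both
   clauses w is the second component rho_y(x) of r (x, y). *)
Definition lambda_system (X : Type) (l : X -> X -> X) : Prop :=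
  [/\ forall x, injective (l x),
      forall x y z w, l (l x y) w = x -> l x (l y z) = l (l x y) (l w z)
    & forall x x' y w, l (l x y) w = x -> l (l x' y) w = x' -> x = x'].

(** The second clause of the system is the first component of the Yang-Baxter equation; the other
    two components follow from it by cancelling injective maps [l e] and [l (l q d)]. *)
Lemma map_of_lambda_solution (X : finType) (l : X -> X -> X) :
  lambda_system l -> solution (map_of_lambda l).
Proof.
case=> l_inj l_yb l_rho; set r := map_of_lambda l.
have finvK x y : l x (finv (l x) y) = y := f_finv (l_inj x) y.
have r_inv : involutive r.
  by case=> x y; rewrite /r /= finvK finv_f.
split=> //; first exact: inv_bij.
  case=> [[x y] z] /=.
  set a := l x y; set b := finv (l a) x; set c := l y z; set d := finv (l c) y.
  have ab : l a b = x by apply: finvK.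
  have cd : l c d = y by apply: finvK.
  have E1 : l a (l b z) = l x c by rewrite -(l_yb x y z b).
  rewrite E1; set e := l x c; set q := finv (l e) x.
  have eq : l e q = x by apply: finvK.
  have E2 : finv (l e) a = l q d.
    by apply: (l_inj e); rewrite finvK -(l_yb x c d q) // cd.
  rewrite E2; congr (_, _, _).
  apply: (l_inj (l q d)); rewrite finvK; apply: (l_inj e); rewrite eq.
  have E3 w := l_yb a (l b z) w (finv (l e) a).
  rewrite E1 in E3.
  by rewrite -E2 -E3 ?finvK.
split=> [x | y]; apply: injF_bij; first exact: l_inj.
move=> x x' E; apply: (l_rho x x' y (rho r y x)); first exact: finvK.
by rewrite E; apply: finvK.
Qed.

(** It lets [r_f] inherit the conditions from [r_Phi] along [Psi]. *)
Lemma lambda_system_transport (X Y : Type) (l : X -> X -> X) (k : Y -> Y -> Y)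
    (g : X -> Y) :
    bijective g -> (forall x y, g (l x y) = k (g x) (g y)) ->
  lambda_system l -> lambda_system k.
Proof.
case=> g' gK g'K gl [l_inj l_yb l_rho]; have g_inj := can_inj gK.
split=> [x | x y z w | x x' y w].
- move=> y z; rewrite -(g'K x) -(g'K y) -(g'K z) -!gl => /g_inj/l_inj.
  by move->.
- rewrite -(g'K x) -(g'K y) -(g'K z) -(g'K w) -!gl => /g_inj /l_yb E.
  by rewrite E.
rewrite -(g'K x) -(g'K x') -(g'K y) -(g'K w) -!gl => /g_inj E /g_inj E'.
by rewrite (l_rho _ _ _ _ E E').
Qed.

Lemma lambda_rho (X : Type) (r : X * X -> X * X) x y :
  involutive r -> lambda r (lambda r x y) (rho r y x) = x.
Proof. by move=> r_inv; rewrite /lambda /rho -surjective_pairing r_inv. Qed.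

Lemma isomorphism_comp (X Y Z : Type) (r : X * X -> X * X) (r' : Y * Y -> Y * Y)
    (r'' : Z * Z -> Z * Z) (g : X -> Y) (h : Y -> Z) :
  isomorphism r r' g -> isomorphism r' r'' h -> isomorphism r r'' (h \o g).
Proof.
case=> g_bij gE [h_bij hE]; split; first exact: bij_comp.
move=> u; have := hE (g u.1, g u.2); have := gE u; rewrite /= => <-.
by move=> <-.
Qed.

(** By [lambda_rho] and injectivity of [lambda r'], the second components are determined by the
    first. *)
Lemma lambda_isomorphism (X Y : Type) (r : X * X -> X * X) (r' : Y * Y -> Y * Y)
    (g : X -> Y) :
    involutive r -> involutive r' -> (forall y, injective (lambda r' y)) ->
    bijective g -> (forall x y, g (lambda r x y) = lambda r' (g x) (g y)) ->
  isomorphism r r' g.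
Proof.
move=> r_inv r'_inv l_inj g_bij gl; split=> // -[x y] /=.
have E : g (rho r y x) = rho r' (g y) (g x).
  apply: (l_inj (g (lambda r x y))); rewrite -gl lambda_rho //.
  by rewrite gl lambda_rho.
by rewrite [RHS]surjective_pairing -[(r' _).1]gl -[(r' _).2]E.
Qed.

End LambdaFamilies.

(** * The solutions built from Phi and alpha *)

Section PhiFamily.

Variable p : nat.
Variables (Phi : 'F_p -> 'F_p) (alpha : 'F_p).
Hypothesis Phi_nc : non_constant Phi.
Hypothesis Phi_even : forall x, Phi x = Phi (- x).
Hypothesis alpha0 : alpha != 0.
Hypothesis PhiM : forall x, Phi (alpha * x) = alpha * Phi x.

Let t := alpha^-1.
Let f i := - Phi (alpha * i).

Lemma PhiV x : Phi (t * x) = t * Phi x.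
Proof. by apply: (mulfI alpha0); rewrite -PhiM !mulVKf. Qed.

Lemma PhiXz x (n : int) : Phi (t ^ n * x) = t ^ n * Phi x.
Proof.
have PhiX c m : (forall y, Phi (c * y) = c * Phi y) -> Phi (c ^+ m * x) = c ^+ m * Phi x.
  by move=> cM; elim: m => [|m IH]; rewrite ?expr0 ?mul1r // exprS -!mulrA cM IH.
case: n => m; first exact/PhiX/PhiV.
rewrite NegzE -exprnN -exprVn; apply: PhiX => y; rewrite invrK; exact: PhiM.
Qed.

Lemma f_admissible : admissible f t.
Proof.
split=> [i | i n |].
- by rewrite /f mulrN -Phi_even.
(* Homogeneity at 0 makes the correction term [(t ^ n - 1) * f 0] vanish. *)
- have E0 : t ^ n * Phi 0 = Phi 0 by rewrite -PhiXz mulr0.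
  by rewrite /f mulr0 mulrCA PhiXz mulrBl mul1r !mulrN E0 subrr subr0.
case=> c fc; apply: Phi_nc; exists (- c) => x.
by rewrite -(fc (t * x)) /f opprK mulVKf.
Qed.

Lemma lambda_Phi_system : lambda_system (lambda_Phi Phi alpha).
Proof.
have t0 : t != 0 by rewrite invr_eq0.
split=> [[a x] [b y] [b' y'] | [a x] [b y] [m n] [c u] | [a x] [a' x'] [b y] [c u]].
- rewrite /= -/t => E; have [/eqP E1 /eqP] := pair_eq_inv E.
  move: E1; rewrite (inj_eq (addIr _)) (inj_eq (mulfI t0)) => /eqP <-.
  by rewrite (inj_eq (addIr _)) (inj_eq (mulfI t0)) => /eqP ->.
- rewrite /= -/t => E; have {E}[Ea Ex] := pair_eq_inv E; rewrite Ea in Ex.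
  rewrite [Phi (a - _)]Phi_even opprB in Ex.
  set q := Phi (t * b - x - a) in Ea Ex *.
  have Eu : t * u = x + q by rewrite -Ex subrK.
  have Ec : t * c = a + (t * y - q) by rewrite -{1}Ea subrK.
  have E1 : t * (t * m - u) - (t * y - q) = t * (t * m - y) - x.
    by rewrite !mulrBr Eu; ring.
  have E2 : t * (t * m - u - c) = t * (t * m - y) - x - a.
    by rewrite !mulrBr Eu Ec; ring.
  have E3 : t * (t * m - y) - x - (t * b - x) = t * (t * m - y - b) by ring.
  rewrite E1 E3; congr (_, _).
  rewrite !(mulrBr t (t * n)) -!PhiV E2; ring.
(* Adding the coordinates eliminates [Phi], so d + e is known; the argument of [Phi] in the first
   coordinate involves only d + e, so d is known too. *)
have sum_eq d e : t * c - (t * y - Phi (t * b - e - d)) = d ->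
    t * u - Phi (t * c - (t * y - Phi (t * b - e - d)) - (t * b - e)) = e ->
    d + e = t * c + t * u - t * y.
  move=> Ed; rewrite [X in X - (t * b - e)]Ed.
  rewrite [Phi (d - _)]Phi_even opprB; move: Ed.
  move: (Phi _) => q Ed Ee; rewrite -{1}Ed -{1}Ee; ring.
rewrite /= -/t => E E'; have [Ea Ex] := pair_eq_inv E; have {E E'}[Ea' Ex'] := pair_eq_inv E'.
have := sum_eq _ _ Ea Ex; have := sum_eq _ _ Ea' Ex' => <- E.
have aa : a = a'.
  rewrite -Ea -Ea'; congr (_ - (_ - Phi _)).
  by rewrite -!addrA -!opprD [x + a]addrC E [x' + a']addrC.
by move: E; rewrite aa => /addrI ->.
Qed.

End PhiFamily.

(** * From solutions of size p^2 to the explicit families *)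

Section Classification.

Variable p : nat.
Hypothesis p_pr : prime p.

Lemma Phi_f_isomorphism (Phi : 'F_p -> 'F_p) (alpha : 'F_p) :
    non_constant Phi -> (forall x, Phi x = Phi (- x)) -> alpha != 0 ->
    (forall x, Phi (alpha * x) = alpha * Phi x) ->
    let t : 'F_p := alpha^-1 in
    let f : 'F_p -> 'F_p := fun i => - Phi (alpha * i) in
    let Psi : 'F_p * 'F_p -> 'F_p * 'F_p := fun u => (u.1, - u.2) in
  admissible f t /\
  [/\ solution (r_Phi Phi alpha), solution (r_f f t)
    & isomorphism (r_Phi Phi alpha) (r_f f t) Psi].
Proof.
move=> Phi_nc Phi_even alpha0 PhiM t f Psi.
have Psi_bij : bijective Psi by exists Psi => -[i j]; rewrite /Psi /= opprK.
have sysPhi := lambda_Phi_system Phi_even alpha0 PhiM.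
have Psi_lam u w : Psi (lambda_Phi Phi alpha u w) = lambda_f f t (Psi u) (Psi w).
  case: u w => [a x] [b y]; rewrite /Psi /f /= -/t; congr (_, _).
  rewrite -[X in - (t * y - Phi X)](mulKf alpha0) (PhiV alpha0 PhiM) -/t; ring.
have sysf := lambda_system_transport Psi_bij Psi_lam sysPhi.
split; first exact: f_admissible.
have solPhi := map_of_lambda_solution sysPhi.
have solf := map_of_lambda_solution sysf.
split=> //; case: solPhi solf => _ _ _ invPhi [_ _ _ invf].
by apply: lambda_isomorphism => //; case: sysf.
Qed.

Lemma stable_setX (X : finType) (r : X * X -> X * X) (S : {set X}) :
    injective r -> (forall x y, x \in S -> y \in S -> lambda r x y \in S) ->
    (forall x y, x \in S -> y \in S -> rho r y x \in S) ->
  r @: setX S S = setX S S.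
Proof.
move=> r_inj lS rS; apply/eqP; rewrite eqEcard card_imset // leqnn andbT.
apply/subsetP=> _ /imsetP[[x y] /setXP[xS yS] ->].
by rewrite [r _]surjective_pairing in_setX lS ?rS.
Qed.

Lemma indecomposable_irretractable_Phi (X : finType) (r : X * X -> X * X) :
    #|X| = (p ^ 2)%N -> solution r -> indecomposable r -> irretractable r ->
  exists (Phi : 'F_p -> 'F_p) (alpha : 'F_p) (g : X -> 'F_p * 'F_p),
    [/\ non_constant Phi, forall x, Phi x = Phi (- x), alpha != 0,
        forall x, Phi (alpha * x) = alpha * Phi x
      & isomorphism r (r_Phi Phi alpha) g].
Proof.
move=> cardX [r_bij yb [l_bij rho_bij] r_inv] indec irr.
have l_inj x : injective (lambda r x) := bij_inj (l_bij x).
(* Passing to inverses turns the Yang-Baxter equation into the cycle set identity. *)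
pose s x : {perm X} := ((perm (l_inj x))^-1)%g.
have sl x y : s x (lambda r x y) = y by rewrite -[lambda r x y](permE (l_inj x)) permK.
have ls x y : lambda r x (s x y) = y by apply: (can_inj (permK (s x))); rewrite sl.
have rhoE x y : rho r y x = s (lambda r x y) x.
  by apply: (l_inj (lambda r x y)); rewrite lambda_rho // ls.
have ybl x y z : lambda r x (lambda r y z) =
    lambda r (lambda r x y) (lambda r (rho r y x) z).
  by have /(congr1 (fun u => u.1.1)) := yb (x, y, z).
have cyc x y : (s x * s (s x y) = s y * s (s y x))%g.
  apply/permP=> u; rewrite !permM.
  apply: (l_inj (s x y)); rewrite ls; apply: (l_inj x); rewrite ls ybl !ls.
  by rewrite rhoE !ls.
(* If c is the square of a, then rho_c(a) = c; elements with the same square therefore collide under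
   the bijection rho_c. *)
have diag : injective (fun x => s x x).
  have rho_fix a : rho r (s a a) a = s a a by rewrite rhoE ls.
  move=> a b /= E; apply: (bij_inj (rho_bij (s a a))).
  by rewrite rho_fix E rho_fix.
have s_inj : injective s.
  move=> x y E; apply: irr => u; apply: (can_inj (permK (s x))).
  by rewrite sl E sl.
pose G := perm_grp s.
have [x0 _] : exists x, x \in [set: X].
  by apply/card_gt0P; rewrite cardsT cardX expn_gt0 prime_gt0.
have stab (S : {set X}) : (forall g x, g \in G -> (g x \in S) = (x \in S)) ->
    r @: setX S S = setX S S.
  move=> GS; apply: stable_setX => [|x y xS yS|x y xS yS]; first exact: bij_inj.
    by rewrite -(GS (s x)) ?s_in_perm_grp // sl.
  by rewrite rhoE GS ?s_in_perm_grp.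
(* Otherwise an orbit and its complement would decompose [r]. *)
have trG : [transitive G, on [set: X] | 'P]%g.
  apply/imsetP; exists x0; rewrite ?inE //; apply/esym/eqP.
  rewrite -subTset; apply/subsetP=> y _; apply/negPn/negP=> yO.
  have orbS g x : g \in G -> (g x \in orbit 'P%act G x0) = (x \in orbit 'P%act G x0).
    by move=> gG; rewrite -[g x]/('P%act x g) orbit_actr.
  apply: indec; exists (orbit 'P%act G x0), (~: orbit 'P%act G x0); split.
    split; [exact: setUCr | exact: setICr | |].
      by apply/set0Pn; exists x0; apply: orbit_refl.
    by apply/set0Pn; exists y; rewrite inE.
  by split; apply: stab => // g x gG; rewrite !inE orbS.
have [t [h [Th [t0 Th_bij hM sE]]]] :=
  prime_square_coordinates cyc diag p_pr cardX s_inj trG.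
have Th_inj := bij_inj Th_bij; case: (Th_bij) => g gK Kg.
have h_even x : h x = h (- x).
  (* At [Th (0, 0)] the two sides have first coordinates t^2 h(x) and t^2 h(-x). *)
  have /permP/(_ (Th (0, 0))) := cyc (Th (0, 0)) (Th (x, 0)).
  rewrite !permM !sE => /Th_inj E; have [+ _] := pair_eq_inv E.
  rewrite !(add0r, addr0, mulr0, subr0).
  by move/(mulfI t0)/(mulfI t0).
have sys := lambda_Phi_system h_even t0 hM.
exists h, t, g; split=> //.
  case=> c hc; have : s (Th (0, 0)) = s (Th (1, 0)).
    by apply/permP=> x; rewrite -(Kg x); case: (g x) => k l; rewrite !sE !hc.
  move/s_inj/Th_inj => E; have [/eqP] := pair_eq_inv E.
  by rewrite eq_sym oner_eq0.
have [_ _ _ Phi_inv] := map_of_lambda_solution sys.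
apply: lambda_isomorphism => //; [by case: sys | by exists Th |].
move=> x y; rewrite -(Kg x) -(Kg y) !gK.
case: (g x) (g y) => [i j] [k l]; apply: Th_inj; rewrite Kg.
apply: (can_inj (permK (s (Th (i, j))))); rewrite sl sE.
congr (Th (_, _)); first by rewrite subrK mulVKf.
by rewrite subrK mulVKf.
Qed.

End Classification.

Theorem mainTheorem3 (p : nat) (p_prime : prime p) :
  (forall (Phi : 'F_p -> 'F_p) (alpha : 'F_p),
     non_constant Phi ->
     (forall x, Phi x = Phi (- x)) ->
     alpha != 0 ->
     (forall x, Phi (alpha * x) = alpha * Phi x) ->
     let t : 'F_p := alpha^-1 in
     let f : 'F_p -> 'F_p := fun i => - Phi (alpha * i) in
     let Psi : 'F_p * 'F_p -> 'F_p * 'F_p := fun u => (u.1, - u.2) in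
     admissible f t /\
     [/\ solution (r_Phi Phi alpha), solution (r_f f t)
       & isomorphism (r_Phi Phi alpha) (r_f f t) Psi])
  /\
  (forall (X : finType) (r : X * X -> X * X),
     #|X| = (p ^ 2)%N ->
     solution r -> indecomposable r -> irretractable r ->
     exists (t : 'F_p) (f : 'F_p -> 'F_p),
       [/\ t != 0, admissible f t
         & exists g : X -> 'F_p * 'F_p, isomorphism r (r_f f t) g]).
Proof.
split=> [Phi alpha Phi_nc Phi_even alpha0 PhiM | X r cardX sol indec irr].
  exact: Phi_f_isomorphism.
have [Phi [alpha [g [Phi_nc Phi_even alpha0 PhiM r_iso]]]] :=
  indecomposable_irretractable_Phi p_prime cardX sol indec irr.
have [adm [_ _ Psi_iso]] := Phi_f_isomorphism Phi_nc Phi_even alpha0 PhiM.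
exists alpha^-1, (fun i => - Phi (alpha * i)).
split=> //; first by rewrite invr_eq0.
by eexists; apply: isomorphism_comp r_iso Psi_iso.
Qed.
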